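(* Let $H$ be a Hilbert space, $I\subseteq\mathbb{R}$ an interval, $f:I\to\mathbb{R}$ an operator convex function on $I$, and $A,B\in\mathcal{SA}_I(H)$. (1) If $p:[0,1]\to\mathbb{R}$ is symmetric, i.e. $p(1-t)=p(t)$ for all $t\in[0,1]$, and non-decreasing on $[0,1/2]$, then in the operator order \[ 0\le \int_0^1 p(t)\,dt\int_0^1 f\big(tA+(1-t)B\big)\,dt-\int_0^1 p(t) f\big(tA+(1-t)B\big)\,dt \] \[ \le \frac14\left[p\left(\tfrac12\right)-p(0)\right]\left[\frac{f(A)+f(B)}{2}-f\left(\frac{A+B}{2}\right)\right]. \] (2) If $p:[0,1]\to\mathbb{R}$ is symmetric, i.e. $p(1-t)=p(t)$ for all $t\in[0,1]$, and non-increasing on $[0,1/2]$, then in the operator order \[ 0\le \int_0^1 p(t) f\big(tA+(1-t)B\big)\,dt-\int_0^1 p(t)\,dt\int_0^1 f\big(tA+(1-t)B\big)\,dt \] \[ \le \frac14\left[p(0)-p\left(\tfrac12\right)\right]\left[\frac{f(A)+f(B)}{2}-f\left(\frac{A+B}{2}\right)\right]. \]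
   Context: $\mathcal{SA}_I(H)$ denotes the class of all (bounded) selfadjoint operators on $H$ with spectrum contained in $I$. For $T\in\mathcal{SA}_I(H)$ and continuous $f:I\to\mathbb{R}$, $f(T)$ is defined by the continuous functional calculus. The operator order on selfadjoint operators is: $S\le T$ iff $\langle Sx,x\rangle\le\langle Tx,x\rangle$ for all $x\in H$. A continuous function $f:I\to\mathbb{R}$ is operator convex on $I$ if $f((1-\lambda)S+\lambda T)\le(1-\lambda)f(S)+\lambda f(T)$ in the operator order for all $\lambda\in[0,1]$ and all $S,T\in\mathcal{SA}_I(H)$. The integrals of operator-valued functions are integrals in $\mathcal{B}(H)$ (so that $\langle(\int_0^1 F(t)\,dt)x,x\rangle=\int_0^1\langle F(t)x,x\rangle\,dt$ for $x\in H$). *)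

(* Defs.v *)
From HB Require Import structures.
From mathcomp Require Import all_boot all_order all_algebra.
From mathcomp Require Import complex.
From mathcomp Require Import all_classical all_reals all_analysis.

Set Implicit Arguments.
Unset Strict Implicit.
Unset Printing Implicit Defensive.

Import Order.TTheory GRing.Theory Num.Theory.
Import numFieldNormedType.Exports.

Local Open Scope classical_set_scope.
Local Open Scope ring_scope.
Local Open Scope complex_scope.

(** A complex Hilbert space is a complete normed space [H] over [R[i]] with a
    positive definite Hermitian form [dot] such that [dot x x = `|x| ^+ 2].
    Operators are plain functions [H -> H], with the pointwise module structure;
    the norm of [H] and the order of [R[i]] are complex-valued ([z <= w] means
    that [w - z] is a nonnegative real). *)

Section BoundedOperators.
Context {R : realType} {H : completeNormedModType R[i]}.
Implicit Types (S T X : H -> H).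

(** Operator norm at most [c]. *)
Definition opnorm_le T (c : R) : Prop := forall x, `|T x| <= c%:C * `|x|.

Definition bounded_op T : Prop := linear T /\ exists c : R, opnorm_le T c.

Definition invertible_op T : Prop :=
  exists S, [/\ bounded_op S, cancel T S & cancel S T].

Definition spectrum T : set R[i] :=
  [set z | ~ invertible_op (T - z *: (idfun : H -> H))].

Definition real_spectrum T : set R := [set r | spectrum T r%:C].

(** Convergence in operator norm. *)
Definition op_cvg (Xn : nat -> H -> H) X : Prop :=
  forall e : R, 0 < e -> \forall n \near \oo, opnorm_le (Xn n - X) e.

Definition poly_op (q : {poly R}) T : H -> H :=
  fun x => \sum_(k < size q) (q`_k)%:C *: iter k T x.

(** Continuous functional calculus of a selfadjoint operator: [f(T)] is the
    operator-norm limit of [q_n(T)] for real polynomials [q_n] converging to [f]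
    uniformly on the spectrum of [T].  Only the values of [f] on the spectrum
    matter. *)
Definition is_cfc (f : R -> R) T X : Prop :=
  exists2 q : nat -> {poly R},
    {uniform real_spectrum T, (fun n (r : R) => (q n).[r]) @ \oo --> f}
    & op_cvg (fun n => poly_op (q n) T) X.

(** [xget] returns the limit when it exists and [0] otherwise. *)
Definition cfc (f : R -> R) T : H -> H := xget 0 [set X | is_cfc f T X].

(** [a :: s] lists the nodes of the partition and [xi i] is the tag of the
    [i]-th cell. *)
Definition tagged_partition (a b : R) (s : seq R) (xi : nat -> R) : Prop :=
  itv_partition a b s /\
  forall i, (i < size s)%N -> nth a (a :: s) i <= xi i <= nth a (a :: s) i.+1.

Definition mesh_lt (a : R) (s : seq R) (d : R) : Prop :=
  forall i, (i < size s)%N -> nth a (a :: s) i.+1 - nth a (a :: s) i < d.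

Definition riemann_sum (F : R -> H -> H) (a : R) (s : seq R) (xi : nat -> R)
    : H -> H :=
  \sum_(i < size s)
    (nth a (a :: s) i.+1 - nth a (a :: s) i)%:C *: F (xi i).

(** Integral in B(H): limit in operator norm of the Riemann sums over tagged
    partitions of [[a, b]] whose mesh tends to 0. *)
Definition is_op_integral (a b : R) (F : R -> H -> H) (J : H -> H) : Prop :=
  forall e : R, 0 < e -> exists2 d : R, 0 < d &
    forall s xi, tagged_partition a b s xi -> mesh_lt a s d ->
      opnorm_le (riemann_sum F a s xi - J) e.

Definition op_integral (a b : R) (F : R -> H -> H) : H -> H :=
  xget 0 [set J | is_op_integral a b F J].

End BoundedOperators.

Section SelfadjointOperators.
Context {R : realType} {H : completeNormedModType R[i]}.
Variable dot : {dot H for @Num.conj R[i]}.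
Implicit Types (S T : H -> H).

Definition selfadjoint T : Prop := forall x y, dot (T x) y = dot x (T y).

(** [spectrum] is complex, hence the embedding of [I] into [R[i]]. *)
Definition SA (I : set R) T : Prop :=
  [/\ bounded_op T, selfadjoint T & spectrum T `<=` [set r%:C | r in I]].

Definition op_le S T : Prop := forall x, dot (S x) x <= dot (T x) x.

Definition operator_convex (I : set R) (f : R -> R) : Prop :=
  {within I, continuous f} /\
  forall (l : R) S T, 0 <= l <= 1 -> SA I S -> SA I T ->
    op_le (cfc f ((1 - l)%:C *: S + l%:C *: T))
          ((1 - l)%:C *: cfc f S + l%:C *: cfc f T).

End SelfadjointOperators.

(* Main.v *)
(** For fixed [x], [phi t = <f(tA + (1-t)B) x, x>] is convex, so its
    symmetrization [psi t = (phi t + phi (1 - t)) / 2] grows with [|t - 1/2|],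
    while [p] decreases with it. Midpoint means of [p] and [p phi] do not see the
    difference between [phi] and [psi]; the Chebyshev sum inequality gives the
    sign, and the Gruss inequality (covariance at most a quarter of the product
    of the ranges) gives the upper bound. Both pass to the limit.

    All integrals exist because [t |-> f(tA + (1-t)B)] is norm continuous and
    [p] has bounded variation: any Riemann sum is compared with the sums over the
    grid [j / n], [n] large. Norm continuity follows from polynomial
    approximation of [f] and the bound [|q(T)| <= sup |q|] over the spectrum.
    For that bound, let [s] be the norm of the selfadjoint operator [q(T)]; then
    [q(T)^2 - s^2] is not bounded below, so by factoring [q^2 - s^2] over [R[i]]
    some spectral point [z] has [q(z)^2 = s^2]. *)

Require Import Defs.
From HB Require Import structures.
From mathcomp Require Import all_boot all_order all_algebra.
From mathcomp Require Import complex.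
From mathcomp Require Import all_classical all_reals all_analysis.
From mathcomp Require Import measurable_realfun ring lra.

Set Implicit Arguments.
Unset Strict Implicit.
Unset Printing Implicit Defensive.

Import Order.TTheory GRing.Theory Num.Theory.
Import numFieldNormedType.Exports.

Local Open Scope classical_set_scope.
Local Open Scope ring_scope.
Local Open Scope complex_scope.

(** * Real-valued norm and inner product *)

Section RealNorm.
Context {R : realType} {H : completeNormedModType R[i]}.
Implicit Types (x y : H) (S T X : H -> H).

(** The order of [R[i]] relates only numbers with equal imaginary parts, so each operator inequality
    has two halves: a real inequality and the vanishing of imaginary parts. Hence the passage to
    real norms and real inner products, the imaginary part of [<u, x>] being the real product of [u]
    with [i x]. [cfc] and [op_integral] are limits selected by [xget] with default 0; existence must
    be shown before either carries information. Since [I] may be open or unbounded, estimates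
    uniform in [t] require one compact interval inside [I] containing the spectra of all
    [tA + (1-t)B]; the extreme spectral points of [A] and [B] span it. On the zero space spectra are
    empty, hence the recurring nonzero vector. The factor 1/4 comes from bounding a variance by a
    quarter of the squared range. The range of [psi] is [psi 0 - psi (1/2)], which is exactly the
    bracket in the theorem. The non-increasing case is the other one applied to [-p]. *)

Definition nrm x : R := complex.Re `|x|.

Lemma nrmE x : `|x| = (nrm x)%:C.
Proof. by rewrite /nrm RRe_real// normr_real. Qed.

Lemma nrm_ge0 x : 0 <= nrm x.
Proof. by rewrite -ler0c -nrmE. Qed.

Lemma nrm_eq0 x : (nrm x == 0) = (x == 0).
Proof. by rewrite -[RHS]normr_eq0 nrmE (inj_eq (@complexI _)). Qed.

Lemma nrm0 : nrm (0 : H) = 0.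
Proof. by apply/eqP; rewrite nrm_eq0. Qed.

Lemma nrmD x y : nrm (x + y) <= nrm x + nrm y.
Proof. by have := ler_normD x y; rewrite !nrmE -rmorphD lecR. Qed.

Lemma nrmN x : nrm (- x) = nrm x.
Proof. by rewrite /nrm normrN. Qed.

Lemma nrm_distC x y : nrm (x - y) = nrm (y - x).
Proof. by rewrite -nrmN opprB. Qed.

Lemma nrmB x y : nrm (x - y) <= nrm x + nrm y.
Proof. by rewrite -(nrmN y) nrmD. Qed.

Lemma nrm_triangle y x z : nrm (x - z) <= nrm (x - y) + nrm (y - z).
Proof. by apply: le_trans (nrmD _ _); rewrite addrA subrK. Qed.

Lemma nrmZ (z : R[i]) x : nrm (z *: x) = complex.Re `|z| * nrm x.
Proof.
by rewrite {1}/nrm normrZ nrmE -(RRe_real (normr_real z)) -rmorphM.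
Qed.

Lemma Re_normC (r : R) : complex.Re `|r%:C| = `|r|.
Proof. by rewrite normc_def /= expr0n /= addr0 sqrtr_sqr. Qed.

Lemma nrmZr (r : R) x : nrm (r%:C *: x) = `|r| * nrm x.
Proof. by rewrite nrmZ Re_normC. Qed.

Lemma nrm_iZ x : nrm ('i%C *: x) = nrm x.
Proof. by rewrite nrmZ normc_def /= expr0n expr1n add0r sqrtr1 mul1r. Qed.

Lemma nrm_sum n (u : 'I_n -> H) (P : pred 'I_n) :
  nrm (\sum_(i < n | P i) u i) <= \sum_(i < n | P i) nrm (u i).
Proof.
elim/big_ind2: _ => [|x a y b xa yb|//]; first by rewrite nrm0.
exact: le_trans (nrmD _ _) (lerD xa yb).
Qed.

Lemma opnorm_leP T c : opnorm_le T c <-> forall x, nrm (T x) <= c * nrm x.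
Proof. by split=> h x; move: (h x); rewrite !nrmE -rmorphM lecR. Qed.

(** Completeness of [H] quantifies over positive [e : R[i]]; such an [e] is real, because positivity
    in [R[i]] forces a zero imaginary part. This brings it to real tolerances. *)
Lemma nrm_complete (u : nat -> H) :
  (forall e : R, 0 < e -> exists N, forall m n, (N <= m)%N -> (N <= n)%N ->
     nrm (u m - u n) <= e) ->
  exists l, forall e : R, 0 < e -> exists N, forall n, (N <= n)%N ->
     nrm (u n - l) <= e.
Proof.
move=> cau.
have realC (e : R[i]) : 0 < e -> exists2 r : R, 0 < r & e = r%:C.
  rewrite ltcE /= => /andP[/eqP ime re0].
  by exists (complex.Re e) => //; case: e ime re0 => a b /= ->.
have : cvgn u.
  apply/cauchy_cvgP/cauchy_exP => e /realC[r r0 ->].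
  have [N hN] := cau (r / 2) (divr_gt0 r0 (ltr0Sn _ 1)).
  exists (u N); exists N => // n /= Nn.
  rewrite -ball_normE /= nrmE ltcR; apply: le_lt_trans (hN _ _ _ Nn) _ => //.
  by rewrite ltr_pdivrMr// ltr_pMr// ltr1n.
move=> /cvg_ex[l /cvgrPdist_le ul]; exists l => e e0.
have := ul e%:C; rewrite ltcR => /(_ e0)[N _ hN]; exists N => n Nn.
by have := hN n Nn; rewrite nrmE lecR nrm_distC.
Qed.

End RealNorm.

Section RealInner.
Context {R : realType} {H : completeNormedModType R[i]}.
Variable dot : {dot H for @Num.conj R[i]}.
Hypothesis dot_norm : forall x : H, dot x x = `|x| ^+ 2.
Implicit Types (x y z : H) (S T : H -> H).

Definition rdot x y : R := complex.Re (dot x y).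

Lemma ReD (a b : R[i]) : complex.Re (a + b) = complex.Re a + complex.Re b.
Proof. by case: a b => [? ?] [? ?]. Qed.

Lemma ReM (r : R) (b : R[i]) : complex.Re (r%:C * b) = r * complex.Re b.
Proof. by case: b => b1 b2 /=; rewrite mul0r subr0. Qed.

Lemma dotDl x y z : dot (x + y) z = dot x z + dot y z.
Proof. exact: linearDl. Qed.

Lemma dotZl (a : R[i]) x z : dot (a *: x) z = a * dot x z.
Proof. exact: linearZl_LR. Qed.

Lemma dotBl x y z : dot (x - y) z = dot x z - dot y z.
Proof. by rewrite -scaleN1r dotDl dotZl mulN1r. Qed.

Lemma dotC x y : dot x y = Num.conj (dot y x).
Proof. by rewrite hermC expr0 mul1r. Qed.

Lemma rdotDl x y z : rdot (x + y) z = rdot x z + rdot y z.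
Proof. by rewrite /rdot dotDl ReD. Qed.

Lemma rdotZl (r : R) x z : rdot (r%:C *: x) z = r * rdot x z.
Proof. by rewrite /rdot dotZl ReM. Qed.

Lemma rdotC x y : rdot x y = rdot y x.
Proof. by rewrite /rdot dotC; case: (dot y x). Qed.

Lemma rdotDr x y z : rdot x (y + z) = rdot x y + rdot x z.
Proof. by rewrite 3!(rdotC x) rdotDl. Qed.

Lemma rdotZr (r : R) x z : rdot x (r%:C *: z) = r * rdot x z.
Proof. by rewrite 2!(rdotC x) rdotZl. Qed.

Lemma rdotNl x y : rdot (- x) y = - rdot x y.
Proof. by rewrite -scaleN1r -(rmorphN1 (real_complex R)) rdotZl mulN1r. Qed.

Lemma rdotBl x y z : rdot (x - y) z = rdot x z - rdot y z.
Proof. by rewrite rdotDl rdotNl. Qed.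

Lemma rdotBr x y z : rdot z (x - y) = rdot z x - rdot z y.
Proof. by rewrite 3!(rdotC z) rdotBl. Qed.

Lemma rdot0l y : rdot 0 y = 0.
Proof. by rewrite -(subrr y) rdotBl subrr. Qed.

Lemma rdot_suml n (u : 'I_n -> H) y :
  rdot (\sum_(i < n) u i) y = \sum_(i < n) rdot (u i) y.
Proof.
by elim/big_rec2: _ => [|i a b _ <-]; rewrite ?rdot0l// rdotDl.
Qed.

Lemma rdotxx x : rdot x x = nrm x ^+ 2.
Proof. by rewrite /rdot dot_norm nrmE -rmorphXn. Qed.

Lemma rdot_le x y : `|rdot x y| <= nrm x * nrm y.
Proof.
have [->|y0] := eqVneq y 0; first by rewrite rdotC rdot0l nrm0 normr0 mulr0.
have ny : 0 < nrm y by rewrite lt_neqAle eq_sym nrm_eq0 y0 nrm_ge0.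
rewrite -(@ler_pXn2r _ 2)// ?nnegrE ?mulr_ge0 ?nrm_ge0//.
rewrite exprMn real_normK ?num_real//.
(* [w] is the component of [x] orthogonal to [y] for the real product, scaled by [|y|^2] to avoid a
   division; [|w|^2 >= 0] is Cauchy-Schwarz times [|y|^2]. *)
set w := (nrm y ^+ 2)%:C *: x - (rdot x y)%:C *: y.
have := sqr_ge0 (nrm w); rewrite -(rdotxx w) /w.
rewrite rdotBl !rdotBr !rdotZl !rdotZr !rdotxx (rdotC y x).
set a := nrm x; set b := nrm y; set c := rdot x y => h.
have b2 : 0 < b ^+ 2 by rewrite exprn_gt0.
rewrite -(ler_pM2l b2) -subr_ge0; apply: le_trans h _.
by rewrite le_eqVlt; apply/orP; left; apply/eqP; ring.
Qed.

Lemma selfadjoint_Im T x : selfadjoint dot T -> complex.Im (dot (T x) x) = 0.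
Proof.
move=> sa; have := dotC (T x) x; rewrite -sa; case: (dot _ _) => a b [h] /=.
lra.
Qed.

Lemma selfadjoint_rdot T x y : selfadjoint dot T -> rdot (T x) y = rdot x (T y).
Proof. by move=> sa; rewrite /rdot sa. Qed.

End RealInner.

(** * Inverses and polynomials of bounded operators *)

Section Operators.
Context {R : realType} {H : completeNormedModType R[i]}.
Implicit Types (x y : H) (S T : H -> H).

Lemma linear_map0 T : linear T -> T 0 = 0.
Proof.
move=> lT; have := lT 1 0 0; rewrite !scale1r addr0 => /eqP.
by rewrite -subr_eq0 opprD addNKr oppr_eq0 => /eqP.
Qed.

Lemma linear_mapD T x y : linear T -> T (x + y) = T x + T y.
Proof. by move=> lT; have := lT 1 x y; rewrite !scale1r. Qed.

Lemma linear_mapZ T (a : R[i]) x : linear T -> T (a *: x) = a *: T x.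
Proof. by move=> lT; have := lT a x 0; rewrite (linear_map0 lT) !addr0. Qed.

Lemma linear_mapB T x y : linear T -> T (x - y) = T x - T y.
Proof.
by move=> lT; rewrite (linear_mapD _ _ lT) -scaleN1r (linear_mapZ _ _ lT) scaleN1r.
Qed.

Lemma bounded_op_gt0 T : bounded_op T -> exists2 c : R, 0 < c & opnorm_le T c.
Proof.
move=> [_ [c /opnorm_leP Tc]]; exists (`|c| + 1).
  by rewrite ltr_wpDl// normr_ge0.
apply/opnorm_leP => x; apply: le_trans (Tc x) _.
by rewrite ler_wpM2r ?nrm_ge0// ler_wpDr// ler_norm.
Qed.

Lemma bounded_op_id : bounded_op (idfun : H -> H).
Proof. by split=> //; exists 1; apply/opnorm_leP => x; rewrite mul1r. Qed.

Lemma bounded_opD S T : bounded_op S -> bounded_op T -> bounded_op (S + T).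
Proof.
move=> [lS [c /opnorm_leP Sc]] [lT [d /opnorm_leP Td]]; split.
  move=> a x y; change (S (a *: x + y) + T (a *: x + y) =
    a *: (S x + T x) + (S y + T y)).
  by rewrite lS lT scalerDr addrACA.
exists (c + d); apply/opnorm_leP => x; rewrite mulrDl.
exact: le_trans (nrmD _ _) (lerD (Sc x) (Td x)).
Qed.

Lemma bounded_opZ (a : R[i]) T : bounded_op T -> bounded_op (a *: T).
Proof.
move=> [lT [d /opnorm_leP Td]]; split.
  move=> b x y; change (a *: T (b *: x + y) = b *: (a *: T x) + a *: T y).
  by rewrite lT scalerDr !scalerA (mulrC a).
exists (complex.Re `|a| * d); apply/opnorm_leP => x.
change (nrm (a *: T x) <= complex.Re `|a| * d * nrm x).
rewrite nrmZ -mulrA ler_wpM2l// -ler0c RRe_real//; exact: normr_real.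
Qed.

Lemma bounded_op_shift T (z : R[i]) :
  bounded_op T -> bounded_op (T + z *: (idfun : H -> H)).
Proof.
by move=> bT; apply: bounded_opD => //; apply: bounded_opZ; exact: bounded_op_id.
Qed.

(** A consequence of invertibility that is stable under composition: if a product of factors [T - z]
    lacks it, so does one factor, and that [z] is a spectral point. *)
Definition bounded_below T :=
  exists2 d : R, 0 < d & forall x, d * nrm x <= nrm (T x).

Lemma invertible_bounded_below T : invertible_op T -> bounded_below T.
Proof.
move=> [S [/bounded_op_gt0[c c0 /opnorm_leP Sc] TK _]].
exists c^-1; first by rewrite invr_gt0.
by move=> x; rewrite ler_pdivrMl//; have := Sc (T x); rewrite TK.
Qed.

Lemma invertible_of_surjective T : bounded_op T -> bounded_below T ->
  (forall y, exists x, T x = y) -> invertible_op T.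
Proof.
move=> [lT _] [d d0 Td] /choice[S SK].
have Tinj x y : T x = T y -> x = y.
  move=> Txy; have := Td (x - y).
  rewrite (linear_mapB _ _ lT) Txy subrr nrm0 pmulr_rle0//.
  by move=> xy; apply/eqP; rewrite -subr_eq0 -nrm_eq0 eq_le xy nrm_ge0.
exists S; split => //; last first.
  by move=> x; apply: Tinj; rewrite SK.
split; first by move=> a x y; apply: Tinj; rewrite SK lT !SK.
exists d^-1; apply/opnorm_leP => x; rewrite ler_pdivlMl//.
by have := Td (S x); rewrite SK.
Qed.

Lemma geometric_small (C q e : R) : 0 <= q < 1 -> 0 < e ->
  exists N, forall n, (N <= n)%N -> `|C * q ^+ n| <= e.
Proof.
move=> /andP[q0 q1] e0.
have : geometric C q @ \oo --> (0 : R) by apply: cvg_geometric; rewrite ger0_norm.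
move/cvgrPdist_le => /(_ e e0)[N _ hN]; exists N => n /hN.
by rewrite /geometric /= sub0r normrN.
Qed.

Lemma contraction_fixpoint (g : H -> H) (q : R) : 0 <= q < 1 ->
  (forall x y, nrm (g x - g y) <= q * nrm (x - y)) -> exists x, g x = x.
Proof.
move=> /andP[q0 q1] gq; pose u n := iter n g 0; pose C := nrm (g 0).
have stepu n : nrm (u n.+1 - u n) <= q ^+ n * C.
  elim: n => [|n IH]; first by rewrite /u /= subr0 expr0 mul1r.
  by apply: le_trans (gq _ _) _; rewrite exprS -mulrA ler_wpM2l.
have q1' : 0 < 1 - q by rewrite subr_gt0.
have cau n m : nrm (u (n + m)%N - u n) <= C / (1 - q) * q ^+ n.
  (* Keeping the term [q ^+ (n + m)] makes the induction on [m] exact: one more step adds precisely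
     [q ^+ (n + m) * C]. *)
  suff: nrm (u (n + m)%N - u n) <= C / (1 - q) * (q ^+ n - q ^+ (n + m)).
    move/le_trans; apply; rewrite ler_wpM2l//.
      by rewrite divr_ge0 ?nrm_ge0 ?ltW.
    by rewrite lerBlDr lerDl exprn_ge0.
  elim: m => [|m IH]; first by rewrite addn0 !subrr nrm0 mulr0.
  apply: le_trans (nrm_triangle (u (n + m)%N) _ _) _.
  rewrite addnS; apply: le_trans (lerD (stepu _) IH) _.
  rewrite le_eqVlt; apply/orP; left; apply/eqP; rewrite exprS.
  by field; rewrite subr_eq0 eq_sym (lt_eqF q1).
have [e e0|l ul] := @nrm_complete _ _ u.
  have [|N hN] := @geometric_small (C / (1 - q)) q e _ e0; first by rewrite q0.
  suff sym m n : (N <= m)%N -> (m <= n)%N -> nrm (u m - u n) <= e.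
    exists N => m n Nm Nn; have [mn|/ltnW nm] := leqP m n; first exact: sym.
    by rewrite nrm_distC sym.
  move=> Nm mn; rewrite nrm_distC -(subnKC mn).
  exact: le_trans (cau _ _) (le_trans (ler_norm _) (hN _ Nm)).
exists l; apply/eqP; rewrite -subr_eq0 -nrm_eq0 eq_le nrm_ge0 andbT.
apply/ler_addgt0Pl => e e0; rewrite addr0.
have [N hN] := ul _ (divr_gt0 e0 (ltr0Sn _ 1)).
apply: le_trans (nrm_triangle (u N.+1) _ _) _.
rewrite (splitr e); apply: lerD; last by apply: hN.
rewrite /u iterS; apply: le_trans (gq _ _) _; rewrite nrm_distC.
apply: le_trans (hN N (leqnn _)); rewrite -/(u N).
by rewrite ler_piMl ?nrm_ge0 ?ltW.
Qed.

(** The equation [S x - z x = y] is the fixed point equation [x = z^-1 (S x - y)], a contraction of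
    ratio [s / |z|]; the lower bound is [|z| - s]. *)
Lemma neumann_invertible S (s : R) (z : R[i]) : bounded_op S -> 0 <= s ->
  opnorm_le S s -> s%:C < `|z| -> invertible_op (S - z *: (idfun : H -> H)).
Proof.
move=> bS s0 /opnorm_leP Ss sz.
set r : R := complex.Re `|z|.
have rE : `|z| = r%:C by rewrite RRe_real// normr_real.
have sr : s < r by rewrite -ltcR -rE.
have r0 : 0 < r by exact: le_lt_trans sr.
have z0 : z != 0 by rewrite -normr_gt0 rE ltcR.
apply: invertible_of_surjective.
- rewrite -scaleNr; exact: bounded_op_shift.
- exists (r - s) => [|x]; first by rewrite subr_gt0.
  rewrite mulrBl; change (r * nrm x - s * nrm x <= nrm (S x - z *: x)).
  rewrite lerBlDr -nrmZ; apply: (@le_trans _ _ (nrm (z *: x - S x) + nrm (S x))).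
    by rewrite -{1}(subrK (S x) (z *: x)) nrmD.
  by rewrite nrm_distC lerD2l Ss.
- move=> y; have [||x xE] := @contraction_fixpoint (fun x => z^-1 *: (S x - y)) (s / r).
  + by rewrite divr_ge0// ?ltW//= ltr_pdivrMr// mul1r.
  + move=> x x'; rewrite -scalerBr opprD opprK addrACA addNr addr0.
    rewrite -(linear_mapB _ _ bS.1).
    rewrite nrmZ normfV rE -(fmorphV (real_complex R)) /= -mulrA mulrCA.
    by rewrite ler_wpM2l ?invr_ge0 ?(ltW r0)// Ss.
  + exists x; change (S x - z *: x = y); rewrite -[in z *: _]xE scalerA divff//.
    by rewrite scale1r opprB addrC subrK.
Qed.

End Operators.

Section PolynomialsOfOperators.
Context {R : realType} {H : completeNormedModType R[i]}.
Implicit Types (x y : H) (S T : H -> H) (p q : {poly R[i]}).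

Lemma bounded_op_comp S T : bounded_op S -> bounded_op T -> bounded_op (S \o T).
Proof.
move=> /[dup][[lS _]] /bounded_op_gt0[c c0 /opnorm_leP Sc] [lT [d /opnorm_leP Td]].
split; first by move=> a x y; rewrite /= lT lS.
exists (c * d); apply/opnorm_leP => x /=; apply: le_trans (Sc _) _.
by rewrite -mulrA ler_wpM2l// ltW.
Qed.

Lemma bounded_below_comp S T :
  bounded_below S -> bounded_below T -> bounded_below (S \o T).
Proof.
move=> [c c0 Sc] [d d0 Td]; exists (c * d); first exact: mulr_gt0.
move=> x /=; apply: le_trans (Sc _).
by rewrite -mulrA ler_wpM2l// ltW.
Qed.

Definition cpoly_op p T : H -> H := fun x => \sum_(k < size p) p`_k *: iter k T x.

Lemma cpoly_op_widen n p T x : (size p <= n)%N ->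
  cpoly_op p T x = \sum_(k < n) p`_k *: iter k T x.
Proof.
move=> pn; rewrite /cpoly_op (big_ord_widen _ (fun k => p`_k *: iter k T x) pn).
rewrite big_mkcond /=; apply: eq_bigr => k _; case: ifPn => //.
by rewrite -leqNgt => /leq_sizeP ->; rewrite ?scale0r.
Qed.

Lemma cpoly_opD p q T x : cpoly_op (p + q) T x = cpoly_op p T x + cpoly_op q T x.
Proof.
pose n := maxn (size p) (size q).
rewrite (@cpoly_op_widen n (p + q)) ?size_polyD// (@cpoly_op_widen n p) ?leq_maxl//.
rewrite (@cpoly_op_widen n q) ?leq_maxr// -big_split /=.
by apply: eq_bigr => k _; rewrite coefD scalerDl.
Qed.

Lemma cpoly_opZ a p T x : cpoly_op (a *: p) T x = a *: cpoly_op p T x.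
Proof.
rewrite (@cpoly_op_widen (size p)) ?size_scale_leq// scaler_sumr.
by apply: eq_bigr => k _; rewrite coefZ scalerA.
Qed.

Lemma cpoly_opC a T x : cpoly_op a%:P T x = a *: x.
Proof. by rewrite (@cpoly_op_widen 1) ?size_polyC_leq1// big_ord1 coefC. Qed.

Lemma cpoly_op0 T x : cpoly_op 0 T x = 0.
Proof. by rewrite -polyC0 cpoly_opC scale0r. Qed.

Lemma cpoly_opMX p T x : cpoly_op (p * 'X) T x = cpoly_op p T (T x).
Proof.
rewrite (@cpoly_op_widen (size p).+1).
  rewrite big_ord_recl coefMX scale0r add0r.
  by apply: eq_bigr => k _; rewrite coefMX iterSr.
have [->|p0] := eqVneq p 0; first by rewrite mul0r size_poly0.
by rewrite size_mulX.
Qed.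

Lemma cpoly_op_comm p T x : linear T -> cpoly_op p T (T x) = T (cpoly_op p T x).
Proof.
move=> lT; rewrite /cpoly_op.
rewrite (big_morph T (fun u v => linear_mapD u v lT) (linear_map0 lT)).
by apply: eq_bigr => k _; rewrite (linear_mapZ _ _ lT) -iterSr.
Qed.

Lemma cpoly_opM p q T x : linear T ->
  cpoly_op (p * q) T x = cpoly_op p T (cpoly_op q T x).
Proof.
move=> lT; elim/poly_ind: p q => [|p a IH] q; first by rewrite mul0r !cpoly_op0.
rewrite mulrDl !cpoly_opD -mulrA -(commr_polyX q) IH !cpoly_opMX cpoly_op_comm//.
by rewrite mul_polyC cpoly_opZ cpoly_opC.
Qed.

Lemma bounded_cpoly_op p T : bounded_op T -> bounded_op (cpoly_op p T).
Proof.
move=> bT; elim/poly_ind: p => [|p a IH].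
  have -> : cpoly_op 0 T = (0 : R[i]) *: (idfun : H -> H).
    by apply/funext => x; rewrite cpoly_op0 -[RHS]/(0 *: x) scale0r.
  exact/bounded_opZ/bounded_op_id.
have -> : cpoly_op (p * 'X + a%:P) T = (cpoly_op p T \o T) + a *: (idfun : H -> H).
  by apply/funext => x; rewrite cpoly_opD cpoly_opMX cpoly_opC.
by apply: bounded_op_shift; exact: bounded_op_comp.
Qed.

Lemma bounded_below_factors (s : seq R[i]) T : linear T ->
  (forall z, z \in s -> bounded_below (T - z *: (idfun : H -> H))) ->
  bounded_below (cpoly_op (\prod_(z <- s) ('X - z%:P)) T).
Proof.
move=> lT; elim: s => [|z s IH] Ts.
  rewrite big_nil; exists 1 => // x.
  by rewrite -polyC1 cpoly_opC scale1r mul1r.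
rewrite big_cons; have -> : cpoly_op (('X - z%:P) * \prod_(j <- s) ('X - j%:P)) T =
   (T - z *: (idfun : H -> H)) \o cpoly_op (\prod_(j <- s) ('X - j%:P)) T.
  apply/funext => x; rewrite cpoly_opM// -polyCN -['X]mul1r -polyC1.
  by rewrite cpoly_opD cpoly_opMX !cpoly_opC scale1r scaleNr.
apply: bounded_below_comp; first by apply: Ts; rewrite mem_head.
by apply: IH => w ws; apply: Ts; rewrite in_cons ws orbT.
Qed.

End PolynomialsOfOperators.

Section RealPolynomials.
Context {R : realType} {H : completeNormedModType R[i]}.
Implicit Types (x y : H) (S T : H -> H) (p q : {poly R}).

Local Notation toC := (map_poly (real_complex R)).

Lemma poly_opE q T : poly_op q T = cpoly_op (toC q) T.
Proof.
apply/funext => x; rewrite /poly_op /cpoly_op size_map_poly.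
by apply: eq_bigr => k _; rewrite coef_map.
Qed.

Lemma poly_opD p q T x : poly_op (p + q) T x = poly_op p T x + poly_op q T x.
Proof. by rewrite !poly_opE rmorphD cpoly_opD. Qed.

Lemma poly_opN p T x : poly_op (- p) T x = - poly_op p T x.
Proof. by rewrite !poly_opE rmorphN -scaleN1r cpoly_opZ scaleN1r. Qed.

Lemma poly_opB p q T x : poly_op (p - q) T x = poly_op p T x - poly_op q T x.
Proof. by rewrite poly_opD poly_opN. Qed.

Lemma poly_opC (a : R) T x : poly_op a%:P T x = a%:C *: x.
Proof. by rewrite poly_opE map_polyC cpoly_opC. Qed.

Lemma poly_opMX p T x : poly_op (p * 'X) T x = poly_op p T (T x).
Proof. by rewrite !poly_opE rmorphM /= map_polyX cpoly_opMX. Qed.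

Lemma poly_opX T x : poly_op 'X T x = T x.
Proof. by rewrite -['X]mul1r -polyC1 poly_opMX poly_opC rmorph1 scale1r. Qed.

Lemma poly_op_comm q T x : linear T -> poly_op q T (T x) = T (poly_op q T x).
Proof. by move=> lT; rewrite poly_opE cpoly_op_comm. Qed.

Lemma poly_opM p q T x : linear T ->
  poly_op (p * q) T x = poly_op p T (poly_op q T x).
Proof. by move=> lT; rewrite !poly_opE rmorphM cpoly_opM. Qed.

Lemma bounded_poly_op q T : bounded_op T -> bounded_op (poly_op q T).
Proof. by rewrite poly_opE; exact: bounded_cpoly_op. Qed.

Variable dot : {dot H for @Num.conj R[i]}.

Lemma selfadjoint_poly_op q T : linear T -> selfadjoint dot T ->
  selfadjoint dot (poly_op q T).
Proof.
move=> lT sT; elim/poly_ind: q => [|q a IH] x y.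
  by rewrite -polyC0 !poly_opC !scale0r linear0l linear0r.
rewrite !poly_opD !poly_opMX !poly_opC dotDl (linearDr dot) IH sT poly_op_comm//.
rewrite dotZl (linearZr_LR dot) /= conj_Creal ?complex_real//.
Qed.

End RealPolynomials.

(** * Spectrum of selfadjoint operators *)

Section SelfadjointSpectrum.
Context {R : realType} {H : completeNormedModType R[i]}.
Variable dot : {dot H for @Num.conj R[i]}.
Hypothesis dot_norm : forall x : H, dot x x = `|x| ^+ 2.
Implicit Types (x y : H) (S T : H -> H) (p q : {poly R}).

Local Notation toC := (map_poly (real_complex R)).

(** [s] is the operator norm of [S]; the last clause supplies nearly maximizing vectors. *)
Definition least_opnorm S (s : R) := [/\ 0 <= s, opnorm_le S s &
  forall t, 0 <= t < s -> exists x, t * nrm x < nrm (S x)].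

Lemma least_opnorm_exists S : bounded_op S -> exists s, least_opnorm S s.
Proof.
move=> [_ [c0 /opnorm_leP Sc0]].
(* Nonnegativity bounds the set below even on the zero space, where every real [c] is an operator
   bound. *)
pose E := [set c : R | 0 <= c /\ opnorm_le S c].
have E0 : E !=set0.
  exists `|c0|; split => //; apply/opnorm_leP => x; apply: le_trans (Sc0 x) _.
  by rewrite ler_wpM2r ?nrm_ge0// ler_norm.
have lbE : lbound E 0 by move=> c [].
exists (inf E); split; first exact: lb_le_inf.
  apply/opnorm_leP => x; have [/eqP|x0] := eqVneq (nrm x) 0.
    rewrite nrm_eq0 => /eqP ->; case: E0 => c [_ /opnorm_leP /(_ 0)].
    by rewrite nrm0 !mulr0.
  have xgt0 : 0 < nrm x by rewrite lt_neqAle eq_sym x0 nrm_ge0.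
  rewrite -ler_pdivrMr//; apply: lb_le_inf => // c [_ /opnorm_leP Sc].
  by rewrite ler_pdivrMr.
move=> t /andP[t0 tE]; apply: contrapT => nx; move: tE; apply/negP; rewrite -leNgt.
apply: ge_inf; first by exists 0.
split=> //; apply/opnorm_leP => x; rewrite leNgt; apply/negP => tx.
by apply: nx; exists x.
Qed.

(** [|(S^2 - s^2) x|^2 <= s^2 (s^2 |x|^2 - |S x|^2)] is small for nearly
    maximizing [x]. *)
Lemma not_bounded_below_least_opnorm S s x0 : x0 != 0 :> H ->
  selfadjoint dot S -> least_opnorm S s ->
  ~ bounded_below (fun x => S (S x) - (s ^+ 2)%:C *: x).
Proof.
move=> x00 sS [s0 /opnorm_leP Ss sup] [d d0 hd].
have key x : nrm (S (S x) - (s ^+ 2)%:C *: x) ^+ 2 <=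
    s ^+ 2 * (s ^+ 2 * nrm x ^+ 2 - nrm (S x) ^+ 2).
  rewrite -(rdotxx dot_norm) rdotBl !rdotBr !rdotZl !rdotZr (rdotC dot x).
  rewrite (selfadjoint_rdot (S x) x sS) !(rdotxx dot_norm).
  have : nrm (S (S x)) ^+ 2 <= s ^+ 2 * nrm (S x) ^+ 2.
    by rewrite -exprMn ler_pXn2r// ?nnegrE ?mulr_ge0 ?nrm_ge0.
  by move=> h; lra.
suff [x dx] : exists x, s ^+ 2 * (s ^+ 2 * nrm x ^+ 2 - nrm (S x) ^+ 2) <
    (d * nrm x) ^+ 2.
  have := le_lt_trans (key x) dx; apply/negP; rewrite -leNgt.
  by rewrite ler_pXn2r ?nnegrE ?nrm_ge0 ?mulr_ge0 ?nrm_ge0 ?(ltW d0)//; exact: hd.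
have [s_eq0|s_neq0] := eqVneq s 0.
  exists x0; rewrite s_eq0 expr0n /= !mul0r exprn_gt0// mulr_gt0//.
  by rewrite lt_neqAle eq_sym nrm_eq0 x00 nrm_ge0.
have sgt0 : 0 < s by rewrite lt_neqAle eq_sym s_neq0.
(* For [|S x| > (s - h) |x|] the right side of [key] stays below
   [s^2 h (2 s - h) |x|^2 <= 4 s^3 h |x|^2], which this [h] makes at most [d^2 |x|^2]. The minimum
   with [s] keeps [s - h] nonnegative. *)
pose h := Num.min s (d ^+ 2 / (4 * s ^+ 3)).
have h0 : 0 < h by rewrite lt_min sgt0 divr_gt0 ?exprn_gt0 ?mulr_gt0 ?exprn_gt0.
have hs : h <= s by rewrite ge_min lexx.
have hd4 : h * (4 * s ^+ 3) <= d ^+ 2.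
  by rewrite -ler_pdivlMr ?mulr_gt0 ?exprn_gt0// ge_min lexx orbT.
have [|x hx] := sup (s - h); first by rewrite subr_ge0 hs ltrBlDr ltrDl.
exists x; set a := nrm x in hx *; set b := nrm (S x) in hx *.
have a_ge0 : 0 <= a := nrm_ge0 x.
have a0 : 0 < a.
  rewrite lt_neqAle a_ge0 andbT eq_sym; apply/eqP => a0.
  by move: hx (Ss x); rewrite -/a -/b a0 !mulr0 => /lt_le_trans h1 /h1; rewrite ltxx.
have b2 : ((s - h) * a) ^+ 2 < b ^+ 2.
  by rewrite ltr_pXn2r ?nnegrE ?mulr_ge0 ?nrm_ge0 ?subr_ge0.
have s2 : 0 < s ^+ 2 by rewrite exprn_gt0.
apply: (@lt_le_trans _ _ (s ^+ 2 * (s ^+ 2 * a ^+ 2 - ((s - h) * a) ^+ 2))).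
  by rewrite ltr_pM2l// ltrD2l ltrN2.
rewrite [(d * a) ^+ 2]exprMn.
apply: (@le_trans _ _ (h * (4 * s ^+ 3) * a ^+ 2)); last first.
  by rewrite ler_wpM2r// exprn_ge0.
have -> : s ^+ 2 * (s ^+ 2 * a ^+ 2 - ((s - h) * a) ^+ 2) =
  (s ^+ 2 * h * (2 * s - h)) * a ^+ 2 by ring.
rewrite ler_wpM2r ?exprn_ge0//.
have -> : h * (4 * s ^+ 3) = s ^+ 2 * h * (4 * s) by ring.
rewrite ler_pM2l ?mulr_gt0//; lra.
Qed.

(** [q^2 - s^2] splits over [R[i]], so one of the factors [T - z] is not bounded
    below. *)
Lemma spectrum_attains_norm q T s x0 : x0 != 0 :> H ->
  bounded_op T -> selfadjoint dot T -> (forall z, spectrum T z -> complex.Im z = 0) ->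
  least_opnorm (poly_op q T) s -> q * q != (s ^+ 2)%:P ->
  exists2 r, real_spectrum T r & q.[r] ^+ 2 = s ^+ 2.
Proof.
move=> x00 bT sT rT qs qneq; pose p := q * q - (s ^+ 2)%:P.
have p0 : toC p != 0 by rewrite map_poly_eq0 subr_eq0.
have lT := bT.1.
have [rs pE] := closed_field_poly_normal (toC p).
have nb : ~ bounded_below (poly_op p T).
  have -> : poly_op p T = fun x => poly_op q T (poly_op q T x) - (s ^+ 2)%:C *: x.
    by apply/funext => x; rewrite poly_opB poly_opM// poly_opC.
  exact: not_bounded_below_least_opnorm x00 (selfadjoint_poly_op _ lT sT) qs.
have [z zrs nz] : exists2 z, z \in rs & ~ bounded_below (T - z *: (idfun : H -> H)).
  apply: contrapT => nex; apply: nb; rewrite poly_opE pE.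
  have [|d d0 hd] := @bounded_below_factors _ _ rs T lT.
    by move=> z zrs; apply: contrapT => nz; apply: nex; exists z.
  have l0 : lead_coef (toC p) != 0 by rewrite lead_coef_eq0.
  have nl0 : 0 < complex.Re `|lead_coef (toC p)|.
    by rewrite -ltcR RRe_real ?normr_real// normr_gt0.
  exists (complex.Re `|lead_coef (toC p)| * d); first exact: mulr_gt0.
  by move=> x; rewrite cpoly_opZ nrmZ -mulrA ler_wpM2l// ltW.
have zT : spectrum T z by move=> /invertible_bounded_below.
have zE : z = (complex.Re z)%:C by have := rT _ zT; case: (z) => a b /= ->.
exists (complex.Re z); first by rewrite /real_spectrum /= -zE.
have : root (toC p) z.
  by rewrite pE rootE hornerZ mulf_eq0 -(rootE _ z) root_prod_XsubC zrs orbT.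
rewrite zE rootE horner_map /= (inj_eq (@complexI _) _ 0) /p hornerD hornerN.
by rewrite hornerM hornerC subr_eq0 expr2 => /eqP.
Qed.

Lemma poly_op_opnorm_le q T c : bounded_op T -> selfadjoint dot T ->
  (forall z, spectrum T z -> complex.Im z = 0) -> 0 <= c ->
  (forall r, real_spectrum T r -> `|q.[r]| <= c) -> opnorm_le (poly_op q T) c.
Proof.
move=> bT sT rT c0 qc.
(* On the zero space the spectrum is empty, so the norm cannot be attained on it; the claim is
   trivial there. *)
have [triv|/existsNP[x0 /eqP x00]] := pselect (forall x : H, x = 0).
  by apply/opnorm_leP => x; rewrite [poly_op _ _ _]triv nrm0 mulr_ge0 ?nrm_ge0.
have [s qs] := least_opnorm_exists (bounded_poly_op q bT).
have [s0 sup _] := qs.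
suff sc : s <= c.
  apply/opnorm_leP => x; move/opnorm_leP: sup => /(_ x)/le_trans; apply.
  by rewrite ler_wpM2r ?nrm_ge0.
have [r rT' rs] : exists2 r, real_spectrum T r & q.[r] ^+ 2 = s ^+ 2.
  (* If [q^2] is the constant [s^2] there is nothing to factor, but then any spectral point will do.
     One exists by the same argument for ['X], whose square is not constant. *)
  have [qq|] := eqVneq (q * q) (s ^+ 2)%:P; last first.
    exact: (spectrum_attains_norm x00 bT sT rT qs).
  have [t Tt] := least_opnorm_exists bT.
  have [||r rT' _] := @spectrum_attains_norm 'X T t x0 x00 bT sT rT.
  - by have -> : poly_op 'X T = T by apply/funext => x; exact: poly_opX.
  - rewrite -expr2; apply/eqP => /(congr1 (fun p : {poly R} => p`_2)).
    by rewrite coefXn coefC /= => /eqP; rewrite oner_eq0.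
  by exists r => //; rewrite expr2 -hornerM qq hornerC.
apply: le_trans (qc r rT').
by rewrite -(@ler_pXn2r _ 2)// ?nnegrE// real_normK ?num_real// rs.
Qed.

End SelfadjointSpectrum.

(** * Resolvents, spectral extrema and the segment joining two operators *)

Section SpectralSegment.
Context {R : realType} {H : completeNormedModType R[i]}.
Variable dot : {dot H for @Num.conj R[i]}.
Hypothesis dot_norm : forall x : H, dot x x = `|x| ^+ 2.
Implicit Types (x y : H) (S T : H -> H).

Lemma rdot_iZ u x : rdot dot u ('i%C *: x) = complex.Im (dot u x).
Proof.
rewrite /rdot (linearZr_LR dot) /=; case: (dot u x) => a b /=.
by rewrite mulN1r opprK mul0r add0r.
Qed.

(** For [z = a + ib] and [w = a - iK], [T - z = (T - w) - i(K + b)] where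
    [|T - w|^2 <= N^2 + K^2 < (K + b)^2]: a Neumann series inverts it. *)
Lemma nonreal_resolvent T z : bounded_op T -> selfadjoint dot T ->
  complex.Im z != 0 -> invertible_op (T - z *: (idfun : H -> H)).
Proof.
move=> bT sT; case: z => a b /= b0.
have bTa := bounded_op_shift (- a%:C) bT.
have [N N0 /opnorm_leP TN] := bounded_op_gt0 bTa.
(* [K] solves [2 K b = N^2], so [(K + b)^2] exceeds [N^2 + K^2] by exactly [b^2]; it has the sign of
   [b]. *)
pose K : R := N ^+ 2 / (2 * b); pose w : R[i] := a%:C - K%:C * 'i%C.
have -> : T - (a +i* b) *: (idfun : H -> H) =
    (T + (- w) *: (idfun : H -> H)) - ((K + b)%:C * 'i%C) *: (idfun : H -> H).
  apply/funext => x.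
  change (T x - (a +i* b) *: x = (T x + - w *: x) - ((K + b)%:C * 'i%C) *: x).
  rewrite -addrA -scalerBl -scaleNr; congr (_ + _ *: x).
  by apply/eqP; rewrite eq_complex /= /w; apply/andP; split; apply/eqP => /=; ring.
have Kb : N ^+ 2 + K ^+ 2 < (K + b) ^+ 2.
  have e2 : 2 * (K * b) = N ^+ 2 by rewrite /K; field.
  have b2 : 0 < b ^+ 2 by rewrite exprn_even_gt0.
  by rewrite sqrrD -mulr_natl e2; lra.
apply: (@neumann_invertible _ _ _ (Num.sqrt (N ^+ 2 + K ^+ 2))).
- exact: bounded_op_shift.
- exact: sqrtr_ge0.
- apply/opnorm_leP => x.
  rewrite -(@ler_pXn2r _ 2)// ?nnegrE ?mulr_ge0 ?nrm_ge0 ?sqrtr_ge0//.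
  rewrite exprMn sqr_sqrtr ?addr_ge0 ?sqr_ge0//.
  have [u uE] : exists u, u = T x - a%:C *: x by eexists.
  have -> : (T + - w *: (idfun : H -> H)) x = u + K%:C *: ('i%C *: x).
    change (T x + - w *: x = u + K%:C *: ('i%C *: x)).
    rewrite uE /w opprB addrC scalerDl scaleNr -scalerA.
    by rewrite [RHS]addrC -addrA [- _ + _]addrC.
  (* [<u, x>] is real, so [u] and [i x] are orthogonal for the real product, and
     [|u + K i x|^2 = |u|^2 + K^2 |x|^2]. *)
  have u0 : rdot dot u ('i%C *: x) = 0.
    rewrite rdot_iZ uE -scaleNr dotDl dotZl.
    case: (dot (T x) x) (selfadjoint_Im x sT) => p q /= ->.
    by rewrite dot_norm nrmE -rmorphXn -rmorphN -rmorphM /= addr0.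
  rewrite -(rdotxx dot_norm) rdotDl !rdotDr !rdotZl !rdotZr (rdotC dot _ u) u0.
  rewrite !(rdotxx dot_norm) nrm_iZ !mulr0 addr0 add0r mulrDl.
  have uN : nrm u ^+ 2 <= N ^+ 2 * nrm x ^+ 2.
    rewrite -exprMn ler_pXn2r ?nnegrE ?mulr_ge0 ?nrm_ge0 ?(ltW N0)//.
    by have := TN x; rewrite uE -scaleNr.
  by apply: lerD => //; rewrite mulrA expr2.
- rewrite normc_def /= !mulr0 mul0r mulr1 subrr addr0 expr0n /= add0r ltcR.
  by rewrite ltr_sqrt//; apply: le_lt_trans Kb; rewrite addr_ge0 ?sqr_ge0.
Qed.

Lemma real_spectrum_shift_le T (c s r : R) : bounded_op T -> 0 <= s ->
  opnorm_le (T + c%:C *: (idfun : H -> H)) s -> real_spectrum T r -> `|r + c| <= s.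
Proof.
move=> bT s0 Ts rT; rewrite leNgt; apply/negP => sr; apply: rT.
have -> : T - r%:C *: (idfun : H -> H) =
    (T + c%:C *: (idfun : H -> H)) - (r + c)%:C *: (idfun : H -> H).
  apply/funext => x; change (T x - r%:C *: x = T x + c%:C *: x - (r + c)%:C *: x).
  by rewrite rmorphD scalerDl opprD addrACA subrr addr0.
apply: neumann_invertible Ts _ => //; first exact: bounded_op_shift.
by rewrite -(RRe_real (normr_real _)) Re_normC ltcR.
Qed.

(** The norm of [T + c] bounds [|r + c|] over the spectrum and is attained at a spectral point, by
    the polynomial ['X + c]; so some spectral point is farthest from [-c]. As the spectrum lies in
    [[-k, k]], the point farthest from [-k] is the maximum and the one farthest from [k] the
    minimum. *)
Lemma spectrum_extrema T x0 : x0 != 0 :> H -> bounded_op T -> selfadjoint dot T ->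
  (forall z, spectrum T z -> complex.Im z = 0) ->
  exists m M, [/\ real_spectrum T m, real_spectrum T M &
    forall r, real_spectrum T r -> m <= r <= M].
Proof.
move=> x00 bT sT rT; have [k k0 Tk] := bounded_op_gt0 bT.
have far (c : R) : exists2 r0, real_spectrum T r0 &
    forall r, real_spectrum T r -> (r + c) ^+ 2 <= (r0 + c) ^+ 2.
  have [s ss] := least_opnorm_exists (bounded_op_shift c%:C bT).
  have [s0 Ts _] := ss.
  have pE : poly_op ('X + c%:P) T = T + c%:C *: (idfun : H -> H).
    by apply/funext => x; rewrite poly_opD poly_opX poly_opC.
  have [||r0 r0T r0s] := @spectrum_attains_norm _ _ dot dot_norm
      ('X + c%:P) T s x0 x00 bT sT rT; first by rewrite pE.
    apply/eqP => /(congr1 (fun p : {poly R} => size p)).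
    rewrite size_Mmonic ?monicXaddC -?size_poly_eq0 ?size_XaddC// size_polyC.
    by case: (_ == 0).
  exists r0 => // r Tr; move: r0s; rewrite hornerD hornerX hornerC => ->.
  have := real_spectrum_shift_le bT s0 Ts Tr.
  by rewrite -(@ler_pXn2r _ 2)// ?nnegrE// real_normK ?num_real.
have Tle r : real_spectrum T r -> - k <= r <= k.
  move=> Tr; rewrite -ler_norml -(addr0 r).
  apply: (real_spectrum_shift_le bT (ltW k0) _ Tr).
  by rewrite rmorph0 scale0r addr0.
have [M MT Mk] := far k; have [m mT mk] := far (- k).
exists m, M; split => // r Tr.
have := Tle _ Tr; have := Tle _ MT; have := Tle _ mT.
move=> /andP[? ?] /andP[? ?] /andP[? ?].
have := Mk _ Tr; have := mk _ Tr.
rewrite -[(r - k) ^+ 2]sqrrN -[(m - k) ^+ 2]sqrrN !opprB.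
rewrite !ler_pXn2r ?nnegrE//; lra.
Qed.

Lemma SA_subset (I J : set R) T : I `<=` J -> SA dot I T -> SA dot J T.
Proof. by move=> IJ [bT sT TI]; split => // z /TI[r /IJ Jr <-]; exists r. Qed.

Lemma selfadjointZr (a : R) T : selfadjoint dot T -> selfadjoint dot (a%:C *: T).
Proof.
move=> sT x y; change (dot (a%:C *: T x) y = dot x (a%:C *: T y)).
by rewrite dotZl (linearZr_LR dot) /= conj_Creal ?complex_real// sT.
Qed.

Lemma selfadjointD S T : selfadjoint dot S -> selfadjoint dot T ->
  selfadjoint dot (S + T).
Proof.
move=> sS sT x y; change (dot (S x + T x) y = dot x (S y + T y)).
by rewrite dotDl (linearDr dot) sS sT.
Qed.

Lemma SA_real I T z : SA dot I T -> spectrum T z -> complex.Im z = 0.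
Proof. by move=> [_ _ TI] /TI[r _ <-]. Qed.

Lemma SA_real_spectrum I T r : SA dot I T -> real_spectrum T r -> I r.
Proof. by move=> [_ _ TI] /TI[s Is /complexI <-]. Qed.

Lemma SA_opnorm_mid (m M : R) T : m <= M -> SA dot `[m, M] T ->
  opnorm_le (T + (- ((m + M) / 2))%:C *: (idfun : H -> H)) ((M - m) / 2).
Proof.
move=> mM TmM; have [bT sT _] := TmM.
have -> : T + (- ((m + M) / 2))%:C *: (idfun : H -> H) =
    poly_op ('X + (- ((m + M) / 2))%:P) T.
  by apply/funext => x; rewrite poly_opD poly_opX poly_opC.
apply: (poly_op_opnorm_le dot_norm) => //.
- by move=> z; exact: SA_real TmM.
- by rewrite divr_ge0 ?subr_ge0.
- move=> r /(SA_real_spectrum TmM); rewrite /= in_itv /= => /andP[mr rM].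
  by rewrite hornerD hornerX hornerC ler_norml; apply/andP; split; lra.
Qed.

(** Membership in [SA `[m, M]] is a norm ball condition, hence convex. *)
Lemma SA_of_opnorm_mid (m M : R) T : bounded_op T -> selfadjoint dot T -> m <= M ->
  opnorm_le (T + (- ((m + M) / 2))%:C *: (idfun : H -> H)) ((M - m) / 2) ->
  SA dot `[m, M] T.
Proof.
move=> bT sT mM Tm; split => // z zT.
have zr : z = (complex.Re z)%:C.
  have : complex.Im z = 0.
    by apply/eqP/negPn/negP => /(nonreal_resolvent bT sT); exact: zT.
  by case: (z) => a b /= ->.
exists (complex.Re z) => //=; rewrite in_itv /=.
have := @real_spectrum_shift_le T (- ((m + M) / 2)) _ (complex.Re z) bT _ Tm.
rewrite divr_ge0 ?subr_ge0// /real_spectrum /= -zr => /(_ isT zT).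
rewrite ler_norml => /andP[? ?]; apply/andP; split; lra.
Qed.

(** Attained extrema are spectral points, hence lie in [I], and so does the compact interval they
    span. The whole segment remains in [SA] of this interval because the operators [tA + (1-t)B]
    stay in the norm ball around the midpoint. *)
Lemma SA_segment (I : set R) A B x0 : x0 != 0 :> H -> is_interval I ->
  SA dot I A -> SA dot I B ->
  exists m M, [/\ m <= M, `[m, M] `<=` I &
    forall t : R, 0 <= t <= 1 -> SA dot `[m, M] (t%:C *: A + (1 - t)%:C *: B)].
Proof.
move=> x00 iI AI BI; have [bA sA _] := AI; have [bB sB _] := BI.
have [a [a' [aA aA' Aa]]] := spectrum_extrema x00 bA sA (fun z => SA_real AI (z := z)).
have [b [b' [bB1 bB' Bb]]] := spectrum_extrema x00 bB sB (fun z => SA_real BI (z := z)).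
pose m := Num.min a b; pose M := Num.max a' b'.
have mM : m <= M.
  by rewrite /m /M ge_min !le_max; have /andP[_ ->] := Aa _ aA.
have seg T (c c' : R) : SA dot I T -> m <= c -> c' <= M ->
    (forall r, real_spectrum T r -> c <= r <= c') -> SA dot `[m, M] T.
  move=> TI mc cM Tc; have [bT sT Tr] := TI; split => // z zT.
  have [r Ir zr] := Tr _ zT; exists r => //=; rewrite in_itv /=.
  move: zT; rewrite -zr => /Tc/andP[cr rc].
  by rewrite (le_trans mc cr) (le_trans rc cM).
have Am : SA dot `[m, M] A by apply: seg AI _ _ Aa; rewrite ?ge_min ?le_max lexx.
have Bm : SA dot `[m, M] B by apply: seg BI _ _ Bb; rewrite ?ge_min ?le_max lexx orbT.
exists m, M; split => //.
- have Im : I m.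
    rewrite /m; case: (leP a b) => _.
      exact: SA_real_spectrum AI aA.
    exact: SA_real_spectrum BI bB1.
  have IM : I M.
    rewrite /M; case: (leP a' b') => _.
      exact: SA_real_spectrum BI bB'.
    exact: SA_real_spectrum AI aA'.
  by move=> r /=; rewrite in_itv /=; exact: iI.
- move=> t /andP[t0 t1]; apply: SA_of_opnorm_mid => //.
  + by apply: bounded_opD; exact: bounded_opZ.
  + by apply: selfadjointD; exact: selfadjointZr.
  + have /opnorm_leP hA := SA_opnorm_mid mM Am.
    have /opnorm_leP hB := SA_opnorm_mid mM Bm.
    apply/opnorm_leP => x; set c : R := - ((m + M) / 2) in hA hB *.
    set rho := (M - m) / 2 in hA hB *.
    have -> : (t%:C *: A + (1 - t)%:C *: B + c%:C *: (idfun : H -> H)) x =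
        t%:C *: (A x + c%:C *: x) + (1 - t)%:C *: (B x + c%:C *: x).
      change (t%:C *: A x + (1 - t)%:C *: B x + c%:C *: x =
        t%:C *: (A x + c%:C *: x) + (1 - t)%:C *: (B x + c%:C *: x)).
      by rewrite !scalerDr addrACA -scalerDl -rmorphD (addrC t) subrK rmorph1 scale1r.
    apply: le_trans (nrmD _ _) _; rewrite !nrmZr !ger0_norm ?subr_ge0//.
    have -> : rho * nrm x = t * (rho * nrm x) + (1 - t) * (rho * nrm x) by ring.
    by apply: lerD; rewrite ler_wpM2l ?subr_ge0//; [exact: hA|exact: hB].
Qed.

End SpectralSegment.

(** * Polynomial approximation and functional calculus *)

Section Weierstrass.
Context {R : realType}.
Implicit Types (f : R -> R) (m M e x : R).

(** Heine's theorem, with compactness in its near-covering form: a property holding near each point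
    for all small [d > 0] holds on the whole segment for all small [d > 0]. *)
Lemma segment_uniform_continuity f m M e : {within `[m, M], continuous f} -> 0 < e ->
  exists2 d : R, 0 < d & forall x y, m <= x <= M -> m <= y <= M ->
    `|x - y| < d -> `|f x - f y| <= e.
Proof.
move=> /subspace_continuousP fc e0.
have := near_covering_withinP `[m, M]; rewrite -compact_near_coveringP.
move=> /iffRL /(_ (@segment_compact R m M)).
move=> /(_ R (0 : R)^'+ (fun d x => forall y, m <= y <= M ->
  `|x - y| < d -> `|f x - f y| <= e)).
case=> [x xmM|d /= d0 hd].
  have e2 : 0 < e / 2 by rewrite divr_gt0.
  have /cvgrPdist_le /(_ _ e2) := fc x xmM.
  rewrite /prop_near1 /within /= => /nbhs_ballP[h /= h0 hh].
  have h2 : 0 < h / 2 by rewrite divr_gt0.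
  have hx y : m <= y <= M -> `|x - y| < h -> `|f x - f y| <= e / 2.
    by move=> ymM xy; apply: hh => //=; rewrite in_itv.
  exists (ball x (h / 2), [set d : R | d < h / 2]).
    split; first exact: nbhsx_ballx.
    exact: nbhs_right_lt.
  move=> [x' d] [/= xx' dh] x'mM y ymM x'y.
  rewrite in_itv /= in x'mM.
  rewrite (splitr e) -(subrKA (f x)); apply: le_trans (ler_normD _ _) _.
  apply: lerD.
    rewrite distrC; apply: hx => //; apply: lt_trans xx' _.
    by rewrite ltr_pdivrMr// ltr_pMr// ltr1n.
  apply: hx => //; rewrite -(subrKA x') (splitr h).
  apply: le_lt_trans (ler_normD _ _) _; apply: ltrD => //.
  exact: lt_trans x'y dh.
have d2 : 0 < d / 2 by rewrite divr_gt0.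
exists (d / 2) => // x y xmM ymM xy; apply: (hd (d / 2)) => //=.
by rewrite sub0r normrN gtr0_norm// ltr_pdivrMr// ltr_pMr// ltr1n.
Qed.

Lemma segment_bounded f m M : {within `[m, M], continuous f} ->
  exists2 C : R, 0 <= C & forall x, m <= x <= M -> `|f x| <= C.
Proof.
move=> fc; have [mM|Mm] := leP m M; last first.
  exists 0 => // x /andP[mx xM]; move: Mm.
  by rewrite ltNge (le_trans mx xM).
have [a _ ha] := EVT_max mM fc; have [b _ hb] := EVT_min mM fc.
exists (`|f a| + `|f b|) => [|x xmM]; first by rewrite addr_ge0.
have := ha x; have := hb x; rewrite in_itv /= xmM => /(_ isT) bx /(_ isT) xa.
rewrite ler_norml; apply/andP; split.
  rewrite opprD; apply: le_trans bx; rewrite addrC lerBlDr.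
  apply: (@le_trans _ _ (f b)); last by rewrite lerDl.
  by rewrite lerNl -normrN ler_norm.
apply: le_trans xa _; apply: le_trans (ler_norm _) _; by rewrite lerDl.
Qed.

(** The mean of [h] under the binomial law of parameters [n] and ['X], by its
    recursion in [n]; binomial coefficients and moment sums are thereby avoided. *)
Fixpoint bernstein n (h : nat -> R) : {poly R} :=
  if n is n'.+1 then (1 - 'X) * bernstein n' h + 'X * bernstein n' (h \o S)
  else (h 0%N)%:P.

Lemma bernsteinS n h x : (bernstein n.+1 h).[x] =
  (1 - x) * (bernstein n h).[x] + x * (bernstein n (h \o S)).[x].
Proof. by rewrite /= !hornerE. Qed.

(** Squared bias plus the binomial variance [n x (1 - x)]. The centre [c] is arbitrary because the
    shift in the recursion of [bernstein] replaces it by [c - 1]. *)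
Lemma bernstein_quad n (a b c x : R) :
  (bernstein n (fun k => a + b * (k%:R - c) ^+ 2)).[x] =
  a + b * ((n%:R * x - c) ^+ 2 + n%:R * x * (1 - x)).
Proof.
elim: n c => [|n IH] c; first by rewrite /= hornerC; ring.
rewrite bernsteinS IH.
have -> : (fun k : nat => a + b * (k%:R - c) ^+ 2) \o S =
    fun k : nat => a + b * (k%:R - (c - 1)) ^+ 2.
  by apply/funext => k /=; rewrite -natr1; congr (_ + _ * _); ring.
by rewrite IH -natr1; ring.
Qed.

(** For [x] in [[0, 1]] each step of the recursion is a convex combination, so pointwise bounds pass
    to the means. *)
Lemma bernstein_dist n (g h : nat -> R) (c x : R) : 0 <= x <= 1 ->
  (forall k, (k <= n)%N -> `|c - g k| <= h k) ->
  `|c - (bernstein n g).[x]| <= (bernstein n h).[x].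
Proof.
move=> /andP[x0 x1]; elim: n g h => [|n IH] g h gh; first by rewrite /= !hornerC gh.
rewrite !bernsteinS.
have -> : c - ((1 - x) * (bernstein n g).[x] + x * (bernstein n (g \o S)).[x]) =
  (1 - x) * (c - (bernstein n g).[x]) + x * (c - (bernstein n (g \o S)).[x]) by ring.
apply: le_trans (ler_normD _ _) _; rewrite !normrM (ger0_norm x0) ger0_norm ?subr_ge0//.
apply: lerD; rewrite ler_wpM2l ?subr_ge0//; apply: IH => k kn.
  by apply: gh; rewrite leqW.
exact: gh.
Qed.

Lemma weierstrass01 (g : R -> R) e : {within `[0, 1], continuous g} -> 0 < e ->
  exists q : {poly R}, forall x, 0 <= x <= 1 -> `|g x - q.[x]| <= e.
Proof.
move=> gc e0; have e2 : 0 < e / 2 by rewrite divr_gt0.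
have [d d0 hd] := segment_uniform_continuity gc e2.
have [C C0 hC] := segment_bounded gc.
(* With this [K], [|g x - g (k/n)| <= e/2 + K (x - k/n)^2] for every [k]: uniform continuity covers
   distances below [d], and from [d] on the quadratic term is at least [2 C]. Its mean is
   [K x (1 - x) / n], whence the choice of [n]. *)
pose K := 2 * C / d ^+ 2.
have K0 : 0 <= K by rewrite divr_ge0 ?mulr_ge0 ?exprn_ge0// ltW.
pose n := (Num.bound (K / (e / 2))).+1.
have n0 : 0 < n%:R :> R by rewrite ltr0n.
have nK : K / n%:R <= e / 2.
  rewrite ler_pdivrMr// mulrC -ler_pdivrMr// ltW//.
  apply: lt_le_trans (archi_boundP _) _; first by rewrite divr_ge0// ltW.
  by rewrite ler_nat.
exists (bernstein n (fun k => g (k%:R / n%:R))) => x x01.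
have := @bernstein_dist n (fun k => g (k%:R / n%:R))
  (fun k => e / 2 + K / n%:R ^+ 2 * (k%:R - n%:R * x) ^+ 2) (g x) x x01.
rewrite bernstein_quad => h; apply: le_trans (h _) _.
  move=> k kn.
  have k01 : 0 <= (k%:R / n%:R : R) <= 1.
    by rewrite divr_ge0 ?ler0n//= ler_pdivrMr// mul1r ler_nat.
  have -> : K / n%:R ^+ 2 * (k%:R - n%:R * x) ^+ 2 = K * (x - k%:R / n%:R) ^+ 2.
    by field; rewrite gt_eqF.
  have [xk|dx] := ltP `|x - k%:R / n%:R| d.
    apply: le_trans (hd _ _ x01 k01 xk) _.
    by rewrite lerDl mulr_ge0 ?sqr_ge0.
  apply: (@le_trans _ _ (2 * C)).
    apply: le_trans (ler_normB _ _) _; rewrite [leRHS]mulr_natl [leRHS]mulr2n.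
    by apply: lerD; exact: hC.
  apply: (@le_trans _ _ (K * (x - k%:R / n%:R) ^+ 2)); last by rewrite lerDr ltW.
  rewrite /K -mulrA ler_peMr ?mulr_ge0// mulrC ler_pdivlMr ?exprn_gt0// mul1r.
  by rewrite -[leRHS]real_normK ?num_real// ler_pXn2r// nnegrE ltW.
rewrite subrr expr0n /= add0r [leRHS](splitr e) lerD2l.
apply: le_trans nK.
have -> : K / n%:R ^+ 2 * (n%:R * x * (1 - x)) = K / n%:R * (x * (1 - x)).
  by field; rewrite gt_eqF.
rewrite ler_piMr//; first by rewrite divr_ge0// ltW.
by case/andP: x01 => x0 x1; rewrite mulr_ile1 ?subr_ge0// gerBl.
Qed.

Lemma weierstrass f m M e : m <= M -> {within `[m, M], continuous f} -> 0 < e ->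
  exists q : {poly R}, forall x, m <= x <= M -> `|f x - q.[x]| <= e.
Proof.
rewrite le_eqVlt => /predU1P[<-|mM] fc e0.
  exists (f m)%:P => x; rewrite -eq_le => /eqP <-.
  by rewrite hornerC subrr normr0 ltW.
have Mm : 0 < M - m by rewrite subr_gt0.
pose g u := f (m + (M - m) * u).
have gc : {within `[0, 1], continuous g}.
  apply/subspace_continuousP => u u01; apply/cvgrPdist_le => d d0.
  have [h h0 hh] := segment_uniform_continuity fc d0.
  apply/nbhs_ballP; exists (h / (M - m)) => /=; first by rewrite divr_gt0.
  have inm v : [set` `[0, 1]] v -> m <= m + (M - m) * v <= M.
    rewrite /= in_itv /= => /andP[v0 v1]; rewrite lerDl mulr_ge0 ?(ltW Mm)//=.
    by rewrite -lerBrDl ler_piMr// ltW.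
  move=> v /= uv v01; apply: hh; [exact: inm|exact: inm|].
  rewrite opprD addrACA subrr add0r -mulrBr normrM gtr0_norm//.
  by rewrite mulrC -ltr_pdivlMr.
have [q hq] := weierstrass01 gc e0.
exists (q \Po ((M - m)^-1 *: ('X - m%:P))) => x /andP[mx xM].
have := hq ((x - m) / (M - m)); rewrite horner_comp hornerZ hornerXsubC [_^-1 * _]mulrC.
rewrite divr_ge0 ?subr_ge0 ?(ltW mM)//= ler_pdivrMr// mul1r lerD2r xM => /(_ isT).
by rewrite /g [(M - m) * _]mulrC divfK ?gt_eqF// (addrC m) subrK.
Qed.

End Weierstrass.

Section FunctionalCalculus.
Context {R : realType} {H : completeNormedModType R[i]}.
Variable dot : {dot H for @Num.conj R[i]}.
Hypothesis dot_norm : forall x : H, dot x x = `|x| ^+ 2.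
Implicit Types (x y : H) (S T X : H -> H) (p q : {poly R}).

(** The limit is taken pointwise. The auxiliary index [k] depends on [x], but the threshold of the
    Cauchy condition does not, so convergence is in operator norm. *)
Lemma opnorm_complete (Xn : nat -> H -> H) :
  (forall e : R, 0 < e -> exists N, forall m n, (N <= m)%N -> (N <= n)%N ->
     opnorm_le (Xn m - Xn n) e) ->
  exists X, forall e : R, 0 < e -> exists N, forall n, (N <= n)%N ->
     opnorm_le (Xn n - X) e.
Proof.
move=> cau.
have /choice[X XE] x : exists l, forall e : R, 0 < e -> exists N, forall n,
    (N <= n)%N -> nrm (Xn n x - l) <= e.
  apply: nrm_complete => e e0.
  (* Dividing the tolerance by [|x| + 1] turns an operator norm bound into an absolute bound at [x],
     including [x = 0]. *)
  have x1 : 0 < nrm x + 1 by rewrite ltr_wpDl// nrm_ge0.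
  have [N hN] := cau _ (divr_gt0 e0 x1); exists N => m n Nm Nn.
  have /opnorm_leP /(_ x) /le_trans -> // := hN m n Nm Nn.
  by rewrite -mulrA ler_piMr ?(ltW e0)// mulrC ler_pdivrMr// mul1r lerDl.
exists X => e e0; have [N hN] := cau e e0; exists N => n Nn.
apply/opnorm_leP => x; apply/ler_addgt0Pr => h h0.
have [N' hN'] := XE x h h0; pose k := maxn N N'.
apply: le_trans (nrm_triangle (Xn k x) _ _) _; apply: lerD.
  by have /opnorm_leP := hN n k Nn (leq_maxl _ _); apply.
exact/hN'/leq_maxr.
Qed.

Lemma uniform_cvgP (A : set R) (g : nat -> R -> R) (f : R -> R) :
  {uniform A, g @ \oo --> f} <-> forall e : R, 0 < e -> exists N, forall n r,
    (N <= n)%N -> A r -> `|f r - g n r| < e.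
Proof.
split=> [gf e e0|gf P /uniform_nbhs[E [entE EP]]].
  have : nbhs (f : {uniform` A -> R}) [set h | forall r, A r -> `|f r - h r| < e].
    apply/uniform_nbhs; exists [set xy | ball xy.1 e xy.2]; split => //.
    exact: (entourage_ball _ (PosNum e0)).
  by move=> /gf[N _ hN]; exists N => n r /hN; exact.
move: entE; rewrite -entourage_ballE => -[e /= e0 eE].
have [N hN] := gf e e0; exists N => // n Nn; apply: EP => r Ar; apply: eE.
exact: hN.
Qed.

Variables (m M : R) (f : R -> R).
Hypothesis mM : m <= M.
Hypothesis fc : {within `[m, M], continuous f}.

Lemma poly_op_close T p q (e : R) : SA dot `[m, M] T -> 0 <= e ->
  (forall r, real_spectrum T r -> `|p.[r] - q.[r]| <= e) ->
  opnorm_le (poly_op p T - poly_op q T) e.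
Proof.
move=> TmM e0 pq; have [bT sT _] := TmM.
have -> : poly_op p T - poly_op q T = poly_op (p - q) T.
  by apply/funext => x; rewrite poly_opB.
apply: (poly_op_opnorm_le dot_norm) => //; first by move=> z; exact: SA_real TmM.
by move=> r /pq; rewrite hornerD hornerN.
Qed.

Lemma opnorm_le_triangle S T X (c d : R) : opnorm_le (S - T) c -> opnorm_le (T - X) d ->
  opnorm_le (S - X) (c + d).
Proof.
move=> /opnorm_leP ST /opnorm_leP TX; apply/opnorm_leP => x; rewrite mulrDl.
exact: le_trans (nrm_triangle (T x) _ _) (lerD (ST x) (TX x)).
Qed.

Lemma opnorm_le_sym S T (c : R) : opnorm_le (S - T) c -> opnorm_le (T - S) c.
Proof.
by move=> /opnorm_leP ST; apply/opnorm_leP => x; rewrite nrm_distC; exact: ST.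
Qed.

Lemma opnorm_le_closed S (c : R) :
  (forall e : R, 0 < e -> opnorm_le S (c + e)) -> opnorm_le S c.
Proof.
move=> Sc; apply/opnorm_leP => x; apply/ler_addgt0Pr => e e0.
have x1 : 0 < nrm x + 1 by rewrite ltr_wpDl// nrm_ge0.
have /opnorm_leP/(_ x)/le_trans := Sc _ (divr_gt0 e0 x1); apply.
rewrite mulrDl lerD2l -mulrA ler_piMr ?(ltW e0)// mulrC ler_pdivrMr// mul1r.
by rewrite lerDl.
Qed.

Lemma cfc_exists T : SA dot `[m, M] T -> exists X, is_cfc f T X.
Proof.
move=> TmM.
have /choice[q qE] (n : nat) : exists q : {poly R}, forall r, m <= r <= M ->
    `|f r - q.[r]| <= n.+1%:R^-1.
  by apply: weierstrass => //; rewrite invr_gt0.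
have small (e : R) : 0 < e -> exists N, forall n, (N <= n)%N ->
    n.+1%:R^-1 < e.
  move=> e0; exists (Num.bound e^-1) => n Nn.
  rewrite invf_plt ?posrE//; apply: lt_le_trans (archi_boundP _) _.
    by rewrite invr_ge0 ltW.
  by rewrite ler_nat leqW.
have spec r : real_spectrum T r -> m <= r <= M.
  by move=> /(SA_real_spectrum TmM); rewrite /= in_itv.
have [e e0|X XE] := @opnorm_complete (fun n => poly_op (q n) T).
  have e2 : 0 < e / 2 by rewrite divr_gt0.
  have [N hN] := small _ e2; exists N => k n Nk Nn.
  apply: poly_op_close => //; first exact: ltW.
  move=> r /spec rmM; rewrite (splitr e) -(subrKA (f r)).
  apply: le_trans (ler_normD _ _) _; apply: lerD.
    by rewrite distrC (le_trans (qE k r rmM))// ltW// hN.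
  by rewrite (le_trans (qE n r rmM))// ltW// hN.
exists X; exists q.
  apply/uniform_cvgP => e /small[N hN]; exists N => n r Nn /spec rmM.
  exact: le_lt_trans (qE n r rmM) (hN n Nn).
move=> e /XE[N hN]; exists N => // n; exact: hN.
Qed.

(** [xget] selects a limit along some unknown sequence [qn]. Passing through a far term of it, which
    is close to [q] on the spectrum, controls whichever limit was selected. *)
Lemma cfc_close T q (e : R) : SA dot `[m, M] T -> 0 <= e ->
  (forall r, m <= r <= M -> `|f r - q.[r]| <= e) ->
  opnorm_le (cfc f T - poly_op q T) e.
Proof.
move=> TmM e0 fq.
have : is_cfc f T (cfc f T) by apply: xgetPex; exact: cfc_exists.
move=> [qn /uniform_cvgP qnf qnT]; apply: opnorm_le_closed => h h0.
have h2 : 0 < h / 2 by rewrite divr_gt0.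
have [N hN] := qnf _ h2; have [N' _ hN'] := qnT _ h2.
pose n := maxn N N'; rewrite (splitr h) addrCA.
apply: (@opnorm_le_triangle _ (poly_op (qn n) T)).
  exact/opnorm_le_sym/hN'/leq_maxr.
apply: poly_op_close => //; first by rewrite addr_ge0 ?(ltW h2).
move=> r rT; rewrite -(subrKA (f r)); apply: le_trans (ler_normD _ _) _.
rewrite addrC; apply: lerD.
  by rewrite distrC ltW// hN// leq_maxl.
by apply: fq; have := SA_real_spectrum TmM rT; rewrite /= in_itv.
Qed.

(** The order of quantifiers is the point: one polynomial serves all operators with spectrum in
    [[m, M]], hence a whole segment at once. *)
Lemma cfc_poly_approx (e : R) : 0 < e -> exists q, forall T, SA dot `[m, M] T ->
  opnorm_le (cfc f T - poly_op q T) e.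
Proof.
move=> e0; have [q hq] := weierstrass mM fc e0.
by exists q => T TmM; apply: cfc_close => //; exact: ltW.
Qed.

Lemma cfc_bounded : exists2 C : R, 0 <= C &
  forall T, SA dot `[m, M] T -> opnorm_le (cfc f T) C.
Proof.
have [C C0 hC] := segment_bounded fc; exists C => // T TmM.
have := @cfc_close T 0 C TmM C0; have -> : poly_op 0 T = 0 :> (H -> H).
  by apply/funext => x; rewrite -polyC0 poly_opC scale0r.
by rewrite subr0; apply => r /hC; rewrite horner0 subr0.
Qed.

(** Real polynomials of [T] are selfadjoint, and the imaginary part, as a real inner product with
    [i x], is continuous under norm approximation. *)
Lemma cfc_dot_Im T x : SA dot `[m, M] T -> complex.Im (dot (cfc f T x) x) = 0.
Proof.
move=> TmM; have [bT sT _] := TmM.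
apply/eqP; rewrite -normr_eq0 eq_le normr_ge0 andbT.
apply/ler_addgt0Pr => e e0; rewrite add0r.
have x1 : 0 < nrm x ^+ 2 + 1 by rewrite ltr_wpDl// exprn_ge0// nrm_ge0.
have [q /(_ T TmM)/opnorm_leP/(_ x) hq] := cfc_poly_approx (divr_gt0 e0 x1).
have qx := selfadjoint_Im x (selfadjoint_poly_op q bT.1 sT).
have -> : complex.Im (dot (cfc f T x) x) =
    rdot dot (cfc f T x - poly_op q T x) ('i%C *: x).
  by rewrite rdotBl !rdot_iZ qx subr0.
apply: le_trans (rdot_le dot_norm _ _) _; rewrite nrm_iZ.
apply: le_trans (ler_wpM2r (nrm_ge0 x) hq) _.
rewrite -mulrA -expr2 -mulrA ler_piMr ?(ltW e0)// mulrC ler_pdivrMr// mul1r.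
by rewrite lerDl.
Qed.

(** Induction along Horner's scheme, from [q(S) S - q(T) T = q(S) (S - T) + (q(S) - q(T)) T]. The
    bound [P] on [q(S)] is carried along for the first summand. *)
Lemma poly_op_lipschitz q (K : R) : exists2 L : R, 0 <= L &
  exists2 P : R, 0 <= P & forall S T, bounded_op S -> bounded_op T ->
    opnorm_le S K -> opnorm_le T K ->
    opnorm_le (poly_op q S) P /\
    forall d : R, 0 <= d -> opnorm_le (S - T) d ->
      opnorm_le (poly_op q S - poly_op q T) (L * d).
Proof.
elim/poly_ind: q => [|q a [L L0 [P P0 IH]]].
  exists 0 => //; exists 0 => // S T _ _ _ _.
  have z U : poly_op 0 U = 0 :> (H -> H).
    by apply/funext => x; rewrite -polyC0 poly_opC scale0r.
  rewrite !z; split=> [|d d0 _]; apply/opnorm_leP => x.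
    by rewrite nrm0 mul0r.
  by rewrite subrr nrm0 !mul0r.
exists (P + L * `|K|); first by rewrite addr_ge0 ?mulr_ge0.
exists (P * `|K| + `|a|); first by rewrite addr_ge0 ?mulr_ge0.
move=> S T bS bT SK TK.
have [/opnorm_leP SP SL] := IH S T bS bT SK TK.
have [/opnorm_leP TP _] := IH T T bT bT TK TK.
move/opnorm_leP: SK => SK; move/opnorm_leP: TK => TK.
have le_absK x U : nrm (U x) <= K * nrm x -> nrm (U x) <= `|K| * nrm x.
  by move=> /le_trans; apply; rewrite ler_wpM2r ?nrm_ge0 ?ler_norm.
split.
  apply/opnorm_leP => x; rewrite poly_opD poly_opMX poly_opC mulrDl.
  apply: le_trans (nrmD _ _) _; rewrite nrmZr lerD2r; apply: le_trans (SP _) _.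
  by rewrite -mulrA ler_wpM2l ?le_absK.
move=> d d0 /[dup] /(SL d d0)/opnorm_leP STL /opnorm_leP STd; apply/opnorm_leP => x.
change (nrm (poly_op (q * 'X + a%:P) S x - poly_op (q * 'X + a%:P) T x) <=
  (P + L * `|K|) * d * nrm x).
rewrite !poly_opD !poly_opMX !poly_opC opprD addrACA subrr addr0.
apply: le_trans (nrm_triangle (poly_op q S (T x)) _ _) _.
rewrite -(linear_mapB _ _ (bounded_poly_op q bS).1) mulrDl mulrDl; apply: lerD.
  apply: le_trans (SP _) _; rewrite -mulrA ler_wpM2l//; exact: STd.
apply: le_trans (STL (T x)) _; rewrite -!mulrA ler_wpM2l// [leRHS]mulrCA ler_wpM2l//.
exact: le_absK.
Qed.

End FunctionalCalculus.

(** * Norm continuity of the functional calculus along a segment *)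

Section Segment.
Context {R : realType} {H : completeNormedModType R[i]}.
Variable dot : {dot H for @Num.conj R[i]}.
Hypothesis dot_norm : forall x : H, dot x x = `|x| ^+ 2.
Variables (m M : R) (f : R -> R) (A B : H -> H).
Hypothesis mM : m <= M.
Hypothesis fc : {within `[m, M], continuous f}.
Hypotheses (bA : bounded_op A) (bB : bounded_op B).

Local Notation opseg t := ((t : R)%:C *: A + (1 - t)%:C *: B).

Hypothesis AB : forall t : R, 0 <= t <= 1 -> SA dot `[m, M] (opseg t).

Lemma cfc_segment_continuous (e : R) : 0 < e -> exists2 d : R, 0 < d &
  forall s t : R, 0 <= s <= 1 -> 0 <= t <= 1 -> `|s - t| <= d ->
    opnorm_le (cfc f (opseg s) - cfc f (opseg t)) e.
Proof.
move=> e0.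
have e3 : 0 < e / 3 by rewrite divr_gt0.
have [q hq] := cfc_poly_approx dot_norm mM fc e3.
have [a a0 /opnorm_leP hA] := bounded_op_gt0 bA.
have [b b0 /opnorm_leP hB] := bounded_op_gt0 bB.
have ab0 : 0 < a + b by exact: addr_gt0.
have [L L0 [P P0 hL]] := @poly_op_lipschitz _ H q (a + b).
have bseg t : bounded_op (opseg t) by apply: bounded_opD; exact: bounded_opZ.
have segN t : 0 <= t <= 1 -> opnorm_le (opseg t) (a + b).
  move=> /andP[t0 t1]; apply/opnorm_leP => x; rewrite mulrDl.
  apply: le_trans (nrmD _ _) _; apply: lerD.
    rewrite nrmZr ger0_norm//; apply: le_trans (hA x).
    by rewrite ler_piMl ?nrm_ge0.
  rewrite nrmZr ger0_norm ?subr_ge0//; apply: le_trans (hB x).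
  by rewrite ler_piMl ?nrm_ge0// gerBl.
have segB s t : opnorm_le (opseg s - opseg t) ((a + b) * `|s - t|).
  apply/opnorm_leP => x.
  have -> : (opseg s - opseg t) x = (s - t)%:C *: (A x - B x).
    change (s%:C *: A x + (1 - s)%:C *: B x - (t%:C *: A x + (1 - t)%:C *: B x) =
      (s - t)%:C *: (A x - B x)).
    rewrite opprD addrACA -!scalerBl -!rmorphB.
    have -> : 1 - s - (1 - t) = - (s - t) by ring.
    by rewrite [in X in _ + X]rmorphN scaleNr scalerBr.
  rewrite nrmZr [leRHS]mulrAC [leRHS]mulrC ler_wpM2l//.
  apply: le_trans (nrmB _ _) _; rewrite mulrDl.
  by apply: lerD.
(* Operators at parameters within [d] differ by at most [(a + b) d], so their polynomials differ by
   at most [e / 3]; [L + 1] replaces [L], which may be 0. *)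
pose d := e / 3 / ((L + 1) * (a + b)).
have L1 : 0 < L + 1 by rewrite ltr_wpDl.
have d0 : 0 < d by rewrite divr_gt0// mulr_gt0.
exists d => // s t s01 t01 st.
have -> : e = e / 3 + (e / 3 + e / 3) by field.
apply: (opnorm_le_triangle (hq _ (AB s01))).
apply: (opnorm_le_triangle _ (opnorm_le_sym (hq _ (AB t01)))).
have [_ /(_ _ _ (segB s t))] := hL _ _ (bseg s) (bseg t) (segN s s01) (segN t t01).
rewrite mulr_ge0 ?(ltW ab0)// => /(_ isT)/opnorm_leP h; apply/opnorm_leP => x.
apply: le_trans (h x) _; rewrite ler_wpM2r ?nrm_ge0//.
apply: (@le_trans _ _ ((L + 1) * ((a + b) * d))).
  apply: ler_pM => //; first by rewrite mulr_ge0 ?(ltW ab0).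
    by rewrite lerDl.
  by rewrite ler_wpM2l ?(ltW ab0).
rewrite /d mulrA mulrC divfK// gt_eqF// mulr_gt0//.
Qed.

End Segment.

(** * Riemann sums *)

Section Partitions.
Context {R : realType}.

Definition node (s : seq R) i : R := nth 0 (0 :: s) i.

Lemma partition_nodes (s : seq R) : itv_partition 0 1 s ->
  [/\ node s 0 = 0, node s (size s) = 1,
      forall i, (i < size s)%N -> node s i < node s i.+1 &
      forall i, (i <= size s)%N -> 0 <= node s i <= 1].
Proof.
move=> /[dup] sP [/(pathP 0) ps /eqP ls]; split=> // [|i is_].
  by rewrite /node -last_nth.
have nE b : nth b (0 :: s) i = node s i by apply: set_nth_default.
by have := @itv_partition_nth_ge _ _ _ _ _ i is_ sP;
   have := @itv_partition_nth_le _ _ _ _ _ i is_ sP; rewrite nE => -> ->.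
Qed.

(** Values in an arbitrary additive group, so that one telescoping identity serves cell lengths,
    increments of a control function, a scalar primitive and partial grid sums in [H]. *)
Lemma sum_node_diff (V : zmodType) (g : R -> V) (s : seq R) : itv_partition 0 1 s ->
  \sum_(i < size s) (g (node s i.+1) - g (node s i)) = g 1 - g 0.
Proof.
move=> /partition_nodes[s0 s1 _ _].
rewrite -(big_mkord xpredT (fun i => g (node s i.+1) - g (node s i))).
by rewrite (telescope_sumr (fun i => g (node s i)))// s0 s1.
Qed.

Definition uniform_partition n : seq R := [seq i.+1%:R / n%:R | i <- iota 0 n].

Lemma size_uniform_partition n : size (uniform_partition n) = n.
Proof. by rewrite size_map size_iota. Qed.

Lemma node_uniform_partition n i : (i <= n)%N ->
  node (uniform_partition n) i = i%:R / n%:R.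
Proof.
case: i => [|i] in_; first by rewrite /node /= mul0r.
by rewrite /node /= (nth_map 0%N) ?size_iota// nth_iota.
Qed.

Lemma uniform_partitionP n : (0 < n)%N -> itv_partition 0 1 (uniform_partition n).
Proof.
move=> n0; have n0' : 0 < n%:R :> R by rewrite ltr0n.
split.
  apply/(pathP 0) => i; rewrite size_uniform_partition => in_.
  rewrite -[X in X < _]/(node (uniform_partition n) i).
  rewrite -[X in _ < X]/(node (uniform_partition n) i.+1).
  by rewrite !node_uniform_partition ?(ltnW in_)// ltr_pM2r ?invr_gt0// ltr_nat.
apply/eqP; rewrite (last_nth 0) -[LHS]/(node _ _) size_uniform_partition.
by rewrite node_uniform_partition// divff// gt_eqF.
Qed.

Lemma uniform_partition_step n i : (0 < n)%N -> (i < n)%N ->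
  node (uniform_partition n) i.+1 - node (uniform_partition n) i = n%:R^-1.
Proof.
move=> n0 in_; rewrite !node_uniform_partition ?(ltnW in_)//.
by rewrite -mulrBl -natr1 addrAC subrr add0r mul1r.
Qed.

Lemma uniform_partition_mesh (d : R) : 0 < d -> exists N, forall n, (N < n)%N ->
  n%:R^-1 < d.
Proof.
move=> d0; exists (Num.bound d^-1) => n Nn.
have dV : 0 <= d^-1 by rewrite invr_ge0 ltW.
have Nd := archi_boundP dV.
have n0 : 0 < n%:R :> R by rewrite ltr0n (leq_ltn_trans _ Nn).
rewrite invf_plt ?posrE//; apply: lt_trans Nd _.
by rewrite ltr_nat.
Qed.

(** The number of grid points [j / n] with [j / n < u], for [0 <= u]. *)
Definition grid_count n (u : R) : nat := `|Num.ceil (u * n%:R)|%N.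

Lemma grid_count_bounds n u : 0 <= u ->
  u * n%:R <= (grid_count n u)%:R < u * n%:R + 1.
Proof.
move=> u0; have un : 0 <= u * n%:R by rewrite mulr_ge0.
have cE : (grid_count n u)%:R = (Num.ceil (u * n%:R))%:~R :> R.
  rewrite /grid_count -[RHS](congr1 (fun z : int => z%:~R) (gez0_abs _))//.
  by rewrite ceil_ge0 (lt_le_trans _ un)// ltrN10.
by have := ceil_itv (u * n%:R); rewrite cE intrD rmorphN1 ltrBlDr => /andP[-> ->].
Qed.

Lemma grid_count0 n : grid_count n 0 = 0%N.
Proof. by rewrite /grid_count mul0r ceil0. Qed.

Lemma grid_count1 n : grid_count n 1 = n.
Proof.
have := @grid_count_bounds n 1 ler01; rewrite mul1r natr1 ler_nat ltr_nat ltnS.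
by move=> ?; apply/eqP; rewrite eqn_leq andbC.
Qed.

Lemma grid_count_le n u w : 0 <= u -> u <= w -> (grid_count n u <= grid_count n w)%N.
Proof.
move=> u0 uw; rewrite -ltnS -(ltr_nat R) -natr1.
have /andP[_ /lt_le_trans -> //] := grid_count_bounds n u0.
have /andP[+ _] := grid_count_bounds n (le_trans u0 uw).
rewrite lerD2r; apply: le_trans; exact: ler_wpM2r.
Qed.

Lemma grid_cell n u w j : (0 < n)%N -> 0 <= u -> 0 <= w ->
  (grid_count n u <= j < grid_count n w)%N -> u <= j%:R / n%:R < w.
Proof.
move=> n0 u0 w0 /andP[uj jw]; have n0' : 0 < n%:R :> R by rewrite ltr0n.
rewrite ler_pdivlMr// ltr_pdivrMr//; apply/andP; split.
  have /andP[h _] := grid_count_bounds n u0.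
  by apply: le_trans h _; rewrite ler_nat.
have /andP[_ h] := grid_count_bounds n w0.
by rewrite -(ltrD2r 1) natr1; apply: le_lt_trans h; rewrite ler_nat.
Qed.

(** The rounding errors of the two ceilings both lie in [[0, 1)], so they differ by less than 1. *)
Lemma grid_cell_size n u w : (0 < n)%N -> 0 <= u -> u <= w ->
  `|(w - u) - (grid_count n w - grid_count n u)%N%:R / n%:R| <= n%:R^-1.
Proof.
move=> n0 u0 uw; have n0' : 0 < n%:R :> R by rewrite ltr0n.
have -> : (w - u) - (grid_count n w - grid_count n u)%N%:R / n%:R =
   ((w * n%:R - (grid_count n w)%:R) - (u * n%:R - (grid_count n u)%:R)) / n%:R.
  rewrite natrB ?grid_count_le//; field; exact: lt0r_neq0.
rewrite normrM [`|_^-1|]gtr0_norm ?invr_gt0// ler_piMl ?invr_ge0 ?ltW//.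
have := grid_count_bounds n u0; have := grid_count_bounds n (le_trans u0 uw).
move=> /andP[? ?] /andP[? ?]; rewrite ltr_norml; apply/andP; split; lra.
Qed.

End Partitions.

(** * Riemann sums of operator functions with controlled oscillation *)

Section RiemannSums.
Context {R : realType} {H : completeNormedModType R[i]}.
Variables (E : R -> H -> H) (v : R -> R) (C K : R).
Hypotheses (C0 : 0 <= C) (K0 : 0 <= K).
(** [E] may jump: its oscillation is bounded by a small term plus an increment of the monotone [v],
    the pattern of a norm continuous function times a weight of bounded variation. *)
Hypothesis v_homo : forall s t : R, 0 <= s -> s <= t -> t <= 1 -> v s <= v t.
Hypothesis E_bound : forall t : R, 0 <= t <= 1 -> opnorm_le (E t) C.
Hypothesis E_mod : forall e : R, 0 < e -> exists2 d : R, 0 < d &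
  forall s t : R, 0 <= s <= 1 -> 0 <= t <= 1 -> `|s - t| <= d ->
    opnorm_le (E s - E t) (e + K * `|v s - v t|).

Definition grid_sum n : H -> H :=
  fun x => \sum_(0 <= j < n) (n%:R^-1)%:C *: E (j%:R / n%:R) x.

Lemma riemann_sumE (F : R -> H -> H) s xi x : riemann_sum F 0 s xi x =
  \sum_(i < size s) (node s i.+1 - node s i)%:C *: F (xi i) x.
Proof. by rewrite /riemann_sum fct_sumE. Qed.

(** If [k] grid points fall in the cell, replacing its length by [k / n] costs [C / n]; moving the
    tag [z] to each grid point then costs [e + K (v w - v u)] with total weight
    [k / n <= w - u + 1/n]. *)
Lemma cell_estimate (e d u w z : R) n x : (0 < n)%N -> 0 <= u -> u <= w -> w <= 1 ->
  0 <= e -> (forall s t : R, 0 <= s <= 1 -> 0 <= t <= 1 -> `|s - t| <= d ->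
    opnorm_le (E s - E t) (e + K * `|v s - v t|)) ->
  w - u < d -> u <= z <= w ->
  nrm ((w - u)%:C *: E z x - \sum_(grid_count n u <= j < grid_count n w)
         (n%:R^-1)%:C *: E (j%:R / n%:R) x)
  <= (C / n%:R + (w - u + n%:R^-1) * (e + K * (v w - v u))) * nrm x.
Proof.
move=> n0 u0 uw w1 e0 hE wud /andP[uz zw]; have n0' : 0 < n%:R :> R by rewrite ltr0n.
have w0 := le_trans u0 uw.
set k := (grid_count n w - grid_count n u)%N.
have kle : k%:R / n%:R <= w - u + n%:R^-1.
  have := grid_cell_size n0 u0 uw; rewrite -/k ler_norml => /andP[h _]; lra.
have z01 : 0 <= z <= 1 by rewrite (le_trans u0 uz) (le_trans zw w1).
pose y : H := (k%:R / n%:R)%:C *: E z x.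
apply: le_trans (nrm_triangle y _ _) _; rewrite mulrDl; apply: lerD.
  rewrite /y -scalerBl -rmorphB nrmZr.
  apply: le_trans (ler_wpM2r (nrm_ge0 _) (grid_cell_size n0 u0 uw)) _.
  rewrite [C / _]mulrC -mulrA ler_wpM2l ?invr_ge0 ?(ltW n0')//.
  by have /opnorm_leP := E_bound z01; apply.
have -> : y = \sum_(grid_count n u <= j < grid_count n w) (n%:R^-1)%:C *: E z x.
  by rewrite sumr_const_nat /y rmorphM /= rmorph_nat -scalerA scaler_nat.
rewrite -sumrB big_nat.
apply: (@le_trans _ _ (\sum_(grid_count n u <= j < grid_count n w)
    n%:R^-1 * ((e + K * (v w - v u)) * nrm x))).
  apply: (@le_trans _ _ (\sum_(grid_count n u <= j < grid_count n w |
     (grid_count n u <= j < grid_count n w)%N)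
     nrm ((n%:R^-1)%:C *: E z x - (n%:R^-1)%:C *: E (j%:R / n%:R) x))).
    elim/big_rec2: _ => [|j a b _ ab]; first by rewrite nrm0.
    exact: le_trans (nrmD _ _) (lerD (lexx _) ab).
  rewrite [leRHS]big_nat; apply: ler_sum => j jc.
  have /andP[uj jw] := grid_cell n0 u0 w0 jc.
  rewrite -scalerBr nrmZr ger0_norm ?invr_ge0 ?(ltW n0')//.
  rewrite ler_wpM2l ?invr_ge0 ?(ltW n0')//.
  have j01 : 0 <= (j%:R / n%:R : R) <= 1.
    by rewrite (le_trans u0 uj) (le_trans (ltW jw) w1).
  have zj : `|z - j%:R / n%:R| <= d.
    apply/ltW; apply: le_lt_trans wud; rewrite ler_norml; apply/andP; split; lra.
  have /opnorm_leP /(_ x)/le_trans := hE _ _ z01 j01 zj; apply.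
  rewrite ler_wpM2r ?nrm_ge0// lerD2l ler_wpM2l// ler_norml.
  have v1 : v u <= v z by apply: v_homo => //; case/andP: z01.
  have v2 : v z <= v w by apply: v_homo => //; case/andP: z01.
  have v3 : v u <= v (j%:R / n%:R) by apply: v_homo => //; case/andP: j01.
  have v4 : v (j%:R / n%:R) <= v w by apply: v_homo (ltW jw) w1; case/andP: j01.
  by apply/andP; split; lra.
rewrite sumr_const_nat -/k -[leLHS]mulr_natl [leLHS]mulrA -[leRHS]mulrA ler_wpM2r//.
by rewrite mulr_ge0 ?nrm_ge0// addr_ge0// mulr_ge0// subr_ge0 v_homo.
Qed.

(** The increments of [v] telescope to [V], so jumps contribute at most [(d + 1/n) K V]. The mesh
    [d] is fixed before the partition, while [N] may depend on its number of cells. *)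
Lemma riemann_sum_grid (e : R) : 0 < e -> exists2 d : R, 0 < d &
  forall s xi, tagged_partition 0 1 s xi -> mesh_lt 0 s d ->
  exists N, forall n, (N < n)%N -> opnorm_le (riemann_sum E 0 s xi - grid_sum n) e.
Proof.
move=> e0; have e4 : 0 < e / 4 by rewrite divr_gt0.
have [d1 d10 hE] := E_mod e4.
pose V := v 1 - v 0.
have V0 : 0 <= V by rewrite subr_ge0 v_homo.
have KV1 : 0 < K * V + 1 by rewrite ltr_wpDl// mulr_ge0.
pose d := Num.min d1 (e / 4 / (K * V + 1)).
have d0 : 0 < d by rewrite lt_min d10 divr_gt0.
exists d => // s xi [sP sxi] smesh.
have [s0 s1 sincr s01] := partition_nodes sP.
pose k : R := (size s)%:R; have k0 : 0 <= k by rewrite ler0n.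
(* All error terms carrying a factor [1/n] add up to less than [q / n]; the summand 1 makes [q]
   positive. *)
pose q := k * (C + e / 4) + K * V + 1.
have q0 : 0 < q by rewrite ltr_wpDl// !addr_ge0 ?mulr_ge0// addr_ge0// ltW.
have [N hN] := uniform_partition_mesh (divr_gt0 e4 q0).
exists N => n Nn; have n0 : (0 < n)%N by exact: leq_ltn_trans Nn.
have n0' : 0 < n%:R :> R by rewrite ltr0n.
have nq : n%:R^-1 * q <= e / 4 by rewrite -ler_pdivlMr// ltW// hN.
apply/opnorm_leP => x.
(* The grid sum up to [u]: its increments over the nodes of [s] distribute the grid points among the
   cells. *)
pose G (u : R) := \sum_(0 <= j < grid_count n u) (n%:R^-1)%:C *: E (j%:R / n%:R) x.
have GE : grid_sum n x = \sum_(i < size s) (G (node s i.+1) - G (node s i)).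
  by rewrite sum_node_diff// /G grid_count0 grid_count1 [X in _ - X]big_geq// subr0.
change (nrm (riemann_sum E 0 s xi x - grid_sum n x) <= e * nrm x).
rewrite riemann_sumE GE -sumrB.
apply: le_trans (nrm_sum _ _) _.
apply: (@le_trans _ _ (\sum_(i < size s)
   ((C / n%:R + (node s i.+1 - node s i + n%:R^-1) * (e / 4)) +
   (d + n%:R^-1) * (K * (v (node s i.+1) - v (node s i)))) * nrm x)).
  apply: ler_sum => i _; have i1 := ltnW (ltn_ord i).
  have /andP[a0 a1] := s01 i i1; have /andP[b0 b1] := s01 i.+1 (ltn_ord i).
  have ab := ltW (sincr i (ltn_ord i)).
  have -> : G (node s i.+1) - G (node s i) =
      \sum_(grid_count n (node s i) <= j < grid_count n (node s i.+1))
         (n%:R^-1)%:C *: E (j%:R / n%:R) x.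
    rewrite /G (big_cat_nat (n := grid_count n (node s i)))//=; last first.
      exact: grid_count_le.
    by rewrite addrAC subrr add0r.
  have mi : node s i.+1 - node s i < d by exact: smesh.
  apply: le_trans (cell_estimate x n0 a0 ab b1 (ltW e4) hE _ (sxi i (ltn_ord i))) _.
    by apply: lt_le_trans mi _; rewrite ge_min lexx.
  rewrite ler_wpM2r ?nrm_ge0// mulrDr addrA lerD2l ler_wpM2r//.
    by rewrite mulr_ge0// subr_ge0 v_homo.
  by rewrite lerD2r ltW.
rewrite -mulr_suml ler_wpM2r ?nrm_ge0// !big_split /= -!mulr_suml -!mulr_sumr.
rewrite (sum_node_diff v sP) -/V big_split /= (sum_node_diff id sP) subr0.
rewrite !sumr_const card_ord -[C *+ _]mulr_natr -[n%:R^-1 *+ _]mulr_natr -/k.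
have dKV : d * (K * V) <= e / 4.
  apply: (@le_trans _ _ (d * (K * V + 1))).
    by rewrite ler_wpM2l ?(ltW d0)// lerDl.
  by rewrite -ler_pdivlMr// ge_min lexx orbT.
have : n%:R^-1 * q = n%:R^-1 * k * (C + e / 4) + n%:R^-1 * (K * V) + n%:R^-1.
  by rewrite /q; ring.
have n1 : 0 <= n%:R^-1 :> R by rewrite invr_ge0 ltW.
move=> qE; rewrite qE in nq.
have -> : C * k / n%:R + (1 + n%:R^-1 * k) * (e / 4) + (d + n%:R^-1) * (K * V) =
  n%:R^-1 * k * (C + e / 4) + n%:R^-1 * (K * V) + e / 4 + d * (K * V) by ring.
lra.
Qed.

(** Two fine grid sums are both close to the Riemann sum of one fixed partition, hence to each
    other; their limit is the integral. *)
Lemma op_integral_exists : exists J, is_op_integral 0 1 E J.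
Proof.
have [e e0|J JE] := @opnorm_complete R H (fun n => grid_sum n.+1).
  have e2 : 0 < e / 2 by rewrite divr_gt0.
  have [d d0 hd] := riemann_sum_grid e2.
  have [N0 hN0] := uniform_partition_mesh d0.
  pose k := N0.+1; pose s : seq R := uniform_partition k.
  have sP : itv_partition 0 1 s by exact: uniform_partitionP.
  have [_ _ sincr _] := partition_nodes sP.
  have [||N hN] := hd s (fun i => node s i).
  - by split=> // i is_; rewrite lexx ltW//; exact: sincr.
  - move=> i; rewrite size_uniform_partition => ik.
    by rewrite -/(node s i) -/(node s i.+1) uniform_partition_step// hN0.
  exists N => m n Nm Nn; rewrite (splitr e).
  apply: opnorm_le_triangle (hN n.+1 _) => //.
  by apply: opnorm_le_sym; exact: hN.
exists J => e e0; have e2 : 0 < e / 2 by rewrite divr_gt0.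
have [d d0 hd] := riemann_sum_grid e2; exists d => // s xi sxi sd.
have [N hN] := hd s xi sxi sd; have [N' hN'] := JE _ e2.
rewrite (splitr e); apply: opnorm_le_triangle (hN' (maxn N N') (leq_maxr _ _)).
by apply: hN; rewrite ltnS leq_maxl.
Qed.

End RiemannSums.

Section MidpointSums.
Context {R : realType} {H : completeNormedModType R[i]}.

(** The map [t |-> 1 - t] permutes the midpoints, which makes symmetrization exact for each [n]. *)
Definition midpoint n i : R := (i%:R + 2^-1) / n%:R.

Lemma midpoint01 n i : (i < n)%N -> 0 <= midpoint n i <= 1.
Proof.
move=> in_; have n0 : 0 < n%:R :> R by rewrite ltr0n (leq_ltn_trans _ in_).
rewrite /midpoint divr_ge0 ?addr_ge0 ?ler0n//= ler_pdivrMr// mul1r.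
apply: (@le_trans _ _ i.+1%:R); rewrite ?ler_nat//.
by rewrite -[i.+1%:R]natr1 lerD2l invf_le1// ler1n.
Qed.

Lemma op_integral_midpoint (F : R -> H -> H) J x (e : R) : is_op_integral 0 1 F J ->
  0 < e -> exists N, forall n, (N < n)%N ->
    nrm (\sum_(i < n) (n%:R^-1)%:C *: F (midpoint n i) x - J x) <= e.
Proof.
move=> FJ e0; have x1 : 0 < nrm x + 1 by rewrite ltr_wpDl// nrm_ge0.
have [d d0 hd] := FJ _ (divr_gt0 e0 x1).
have [N hN] := uniform_partition_mesh d0; exists N => n Nn.
have n0 : (0 < n)%N by exact: leq_ltn_trans Nn.
have n0' : 0 < n%:R :> R by rewrite ltr0n.
pose s : seq R := uniform_partition n.
have sP : itv_partition 0 1 s by exact: uniform_partitionP.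
have tP : tagged_partition 0 1 s (midpoint n).
  split=> // i; rewrite size_uniform_partition => in_.
  rewrite -/(node s i) -/(node s i.+1) !node_uniform_partition ?(ltnW in_)//.
  rewrite /midpoint !ler_pM2r ?invr_gt0// lerDl invr_ge0 ler0n/=.
  by rewrite -[i.+1%:R]natr1 lerD2l invf_le1// ler1n.
have sm : mesh_lt 0 s d.
  move=> i; rewrite size_uniform_partition => in_.
  by rewrite -/(node s i) -/(node s i.+1) uniform_partition_step// hN.
have /opnorm_leP/(_ x) := hd s (midpoint n) tP sm.
have -> : (riemann_sum F 0 s (midpoint n) - J) x =
    \sum_(i < n) (n%:R^-1)%:C *: F (midpoint n i) x - J x.
  change (riemann_sum F 0 s (midpoint n) x - J x =
    \sum_(i < n) (n%:R^-1)%:C *: F (midpoint n i) x - J x).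
  rewrite riemann_sumE size_uniform_partition; congr (_ - _).
  by apply: eq_bigr => i _; rewrite uniform_partition_step.
move=> /le_trans; apply.
rewrite -mulrA ler_piMr ?(ltW e0)// mulrC ler_pdivrMr// mul1r.
by rewrite lerDl.
Qed.

End MidpointSums.

(** * Chebyshev and Gruss inequalities for midpoint means *)

Section Scalar.
Context {R : realType}.
Implicit Types (p v phi : R -> R).

Definition midpoint_mean n (g : R -> R) : R := \sum_(i < n) n%:R^-1 * g (midpoint n i).

(** Lower bound: the double mean of [-(a i - a j) (b i - b j)] is twice the middle term. Upper
    bound: scaling each sequence by the range of the other gives both the variance bound
    [(al be)^2 / 4], and the variance of the sum is nonnegative. *)
Lemma covariance_bounds n (a b : 'I_n -> R) (a0 a1 b0 b1 : R) : (0 < n)%N ->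
  (forall i, a0 <= a i <= a1) -> (forall i, b0 <= b i <= b1) ->
  (forall i j, (a i - a j) * (b i - b j) <= 0) ->
  0 <= (\sum_(i < n) n%:R^-1 * a i) * (\sum_(i < n) n%:R^-1 * b i)
       - \sum_(i < n) n%:R^-1 * (a i * b i) <= 4^-1 * (a1 - a0) * (b1 - b0).
Proof.
move=> n0 ha hb hab; have n0' : 0 < n%:R :> R by rewrite ltr0n.
set w : R := n%:R^-1; have w0 : 0 <= w by rewrite invr_ge0 ltW.
pose mu (c : 'I_n -> R) := \sum_(i < n) w * c i.
have mu_ge0 c : (forall i, 0 <= c i) -> 0 <= mu c.
  by move=> c0; apply: sumr_ge0 => i _; rewrite mulr_ge0.
have muD c d : mu (fun i => c i + d i) = mu c + mu d.
  by rewrite /mu -big_split; apply: eq_bigr => i _; rewrite /= mulrDr.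
have muZ k c : mu (fun i => k * c i) = k * mu c.
  by rewrite /mu mulr_sumr; apply: eq_bigr => i _; rewrite mulrCA.
have muC k : mu (fun=> k) = k.
  by rewrite /mu sumr_const card_ord -[LHS]mulr_natl mulrA divff ?mul1r ?gt_eqF.
rewrite -/(mu a) -/(mu b) -/(mu (fun i => a i * b i)).
set sa := mu a; set sb := mu b; set sab := mu _.
have cheb : 0 <= sa * sb - sab.
  have : 0 <= mu (fun i => mu (fun j => - ((a i - a j) * (b i - b j)))).
    by apply: (mu_ge0) => i; apply: (mu_ge0) => j; rewrite oppr_ge0.
  have -> : (fun i => mu (fun j => - ((a i - a j) * (b i - b j)))) =
      fun i => (- 1) * (a i * b i) + (sb * a i + (sa * b i + - sab)).
    apply/funext => i.
    have -> : (fun j => - ((a i - a j) * (b i - b j))) =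
        fun j => - (a i * b i) + (a i * b j + (b i * a j + (-1) * (a j * b j))).
      by apply/funext => j; ring.
    by rewrite !muD !muZ muC -/sa -/sb -/sab; ring.
  rewrite !muD !muZ muC -/sa -/sb -/sab => h; lra.
rewrite cheb /=.
(* Popoviciu's inequality, from the nonnegative mean of [(c - c0) (c1 - c)] and the square of
   [2 mu c - (c0 + c1)]. *)
have var_le c c0 c1 : (forall i, c0 <= c i <= c1) ->
    mu (fun i => c i ^+ 2) - mu c ^+ 2 <= 4^-1 * (c1 - c0) ^+ 2.
  move=> hc; have : 0 <= mu (fun i => (c i - c0) * (c1 - c i)).
    by apply: mu_ge0 => i; have /andP[? ?] := hc i; rewrite mulr_ge0 ?subr_ge0.
  have -> : (fun i => (c i - c0) * (c1 - c i)) =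
      fun i => (-1) * c i ^+ 2 + ((c0 + c1) * c i + - (c0 * c1)).
    by apply/funext => i; ring.
  rewrite !muD !muZ muC.
  by have := sqr_ge0 (2 * mu c - (c0 + c1)); rewrite !expr2 => ? ?; lra.
set al := a1 - a0; set be := b1 - b0.
have va : mu (fun i => a i ^+ 2) - sa ^+ 2 <= 4^-1 * al ^+ 2 := var_le _ _ _ ha.
have vb : mu (fun i => b i ^+ 2) - sb ^+ 2 <= 4^-1 * be ^+ 2 := var_le _ _ _ hb.
have al0 : 0 <= al.
  by have /andP[h1 h2] := ha (Ordinal n0); rewrite subr_ge0 (le_trans h1 h2).
have be0 : 0 <= be.
  by have /andP[h1 h2] := hb (Ordinal n0); rewrite subr_ge0 (le_trans h1 h2).
(* A sequence of zero range is constant and its covariance vanishes; settling this case allows the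
   factor [al * be] to be cancelled at the end. *)
have deg (c : 'I_n -> R) c0 c1 : (forall i, c0 <= c i <= c1) -> c1 - c0 = 0 ->
    forall i, c i = c0.
  move=> hc /eqP; rewrite subr_eq0 => /eqP c10 i; have := hc i.
  by rewrite c10 -eq_le => /eqP.
have [ale|aln] := eqVneq al 0.
  have aE : a = fun=> a0 by apply/funext; exact: deg ha ale.
  have -> : sab = sa * sb by rewrite /sab /sa aE muZ muC.
  by rewrite subrr ale mulr0 mul0r.
have [bee|ben] := eqVneq be 0.
  have bE : b = fun=> b0 by apply/funext; exact: deg hb bee.
  have -> : sab = sa * sb.
    rewrite /sab /sb bE muC mulrC -muZ; congr mu; apply/funext => i; exact: mulrC.
  by rewrite subrr bee mulr0.
have ab0 : 0 < al * be by rewrite mulr_gt0// lt_neqAle eq_sym ?aln ?ben.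
(* the variance of [be * a + al * b] is nonnegative *)
have : 0 <= mu (fun i => (be * (a i - sa) + al * (b i - sb)) ^+ 2).
  by apply: mu_ge0 => i; exact: sqr_ge0.
have -> : (fun i => (be * (a i - sa) + al * (b i - sb)) ^+ 2) =
    fun i => be ^+ 2 * a i ^+ 2 + (al ^+ 2 * b i ^+ 2 + (2 * al * be * (a i * b i) +
      ((- 2 * be * (be * sa + al * sb)) * a i + ((- 2 * al * (be * sa + al * sb)) * b i +
      (be * sa + al * sb) ^+ 2)))).
  by apply/funext => i; ring.
rewrite !muD !muZ muC -/sa -/sb -/sab.
set saa := mu _ in va *; set sbb := mu _ in vb *.
have e1 : be ^+ 2 * (saa - sa ^+ 2) <= be ^+ 2 * (4^-1 * al ^+ 2).
  by rewrite ler_wpM2l ?sqr_ge0.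
have e2 : al ^+ 2 * (sbb - sb ^+ 2) <= al ^+ 2 * (4^-1 * be ^+ 2).
  by rewrite ler_wpM2l ?sqr_ge0.
move=> h; rewrite -(ler_pM2l ab0); move: e1 e2 h; rewrite !expr2 => e1 e2 h; lra.
Qed.

Lemma midpoint_rev n (i : 'I_n) : midpoint n (rev_ord i) = 1 - midpoint n i :> R.
Proof.
have n0 : 0 < n%:R :> R by rewrite ltr0n (leq_ltn_trans _ (ltn_ord i)).
rewrite /midpoint /= natrB// -natr1; field; exact: lt0r_neq0.
Qed.

(** Both points are folded onto [[0, 1/2]], where being nearer to [1/2] means being larger. *)
Lemma symmetric_monotone p s t : (forall t, 0 <= t <= 1 -> p (1 - t) = p t) ->
  {in `[0, 2^-1]%R &, {homo p : s t / s <= t}} ->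
  0 <= s <= 1 -> 0 <= t <= 1 -> `|t - 2^-1| <= `|s - 2^-1| -> p s <= p t.
Proof.
move=> psym pmon.
have fold u : 0 <= u <= 1 -> exists u', [/\ 0 <= u' <= 2^-1, p u = p u' &
    `|u - 2^-1| = 2^-1 - u'].
  move=> /[dup] u01 /andP[u0 u1]; have [uh|uh] := leP u 2^-1.
    by exists u; rewrite u0 uh distrC ger0_norm ?subr_ge0.
  exists (1 - u); split; last by rewrite gtr0_norm ?subr_gt0//; lra.
    by apply/andP; split; lra.
  by rewrite psym.
move=> /fold[s' [s'h -> ->]] /fold[t' [t'h -> ->]] st.
by apply: pmon; rewrite ?in_itv//=; lra.
Qed.

(** [t] lies between [s] and [1 - s], so [t] and [1 - t] are convex combinations of these two with
    exchanged weights; the weights cancel when the two convexity inequalities are added. The centre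
    [s = 1/2], where [l] is undefined, is separate. *)
Lemma convex_symmetrization phi s t :
  (forall l s t : R, 0 <= l <= 1 -> 0 <= s <= 1 -> 0 <= t <= 1 ->
     phi ((1 - l) * s + l * t) <= (1 - l) * phi s + l * phi t) ->
  0 <= s <= 1 -> 0 <= t <= 1 -> `|t - 2^-1| <= `|s - 2^-1| ->
  phi t + phi (1 - t) <= phi s + phi (1 - s).
Proof.
move=> cvx s01 t01 ts; have s01' : 0 <= 1 - s <= 1.
  by case/andP: s01 => ? ?; apply/andP; split; lra.
have [sE|sN] := eqVneq s 2^-1.
  have -> : t = s.
    move: ts; rewrite sE subrr normr0 normr_le0 subr_eq0 => /eqP ->.
    by [].
  by [].
have d0 : 1 - 2 * s != 0.
  by apply: contraNneq sN => h; apply/eqP; lra.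
pose l := (t - s) / (1 - 2 * s).
have l01 : 0 <= l <= 1.
  move: ts; have [sh|sh|sh] := ltgtP s 2^-1; last by rewrite sh eqxx in sN.
    rewrite [`|s - _|]ltr0_norm ?subr_lt0// ler_norml => /andP[? ?].
    have dp : 0 < 1 - 2 * s by lra.
    by rewrite /l divr_ge0 ?(ltW dp)//= ?ler_pdivrMr//; lra.
  rewrite [`|s - _|]gtr0_norm ?subr_gt0// ler_norml => /andP[? ?].
  have dp : 0 < 2 * s - 1 by lra.
  have -> : l = (s - t) / (2 * s - 1).
    by rewrite /l -[s - t]opprB -[2 * s - 1]opprB invrN mulrNN.
  by rewrite divr_ge0 ?(ltW dp)//= ?ler_pdivrMr//; lra.
have -> : t = (1 - l) * s + l * (1 - s) by rewrite /l; field.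
have -> : 1 - ((1 - l) * s + l * (1 - s)) = (1 - l) * (1 - s) + l * s by ring.
have h1 := cvx l s (1 - s) l01 s01 s01'; have h2 := cvx l (1 - s) s l01 s01' s01.
lra.
Qed.

(** On [[0, 1]] the distance to [1/2] is largest at 0 and least at [1/2], so [p] has values in
    [[p 0, p (1/2)]] and [psi] in [[psi (1/2), psi 0]], with opposite monotonicity. *)
Lemma midpoint_chebyshev_gruss p phi n : (0 < n)%N ->
  (forall t, 0 <= t <= 1 -> p (1 - t) = p t) ->
  {in `[0, 2^-1]%R &, {homo p : s t / s <= t}} ->
  (forall l s t : R, 0 <= l <= 1 -> 0 <= s <= 1 -> 0 <= t <= 1 ->
     phi ((1 - l) * s + l * t) <= (1 - l) * phi s + l * phi t) ->
  0 <= midpoint_mean n p * midpoint_mean n phi - midpoint_mean n (fun t => p t * phi t)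
    <= 4^-1 * (p 2^-1 - p 0) * (2^-1 * (phi 0 + phi 1) - phi 2^-1).
Proof.
move=> n0 psym pmon cvx.
pose psi t := 2^-1 * (phi t + phi (1 - t)).
have psi_le s t : 0 <= s <= 1 -> 0 <= t <= 1 -> `|t - 2^-1| <= `|s - 2^-1| ->
    psi t <= psi s.
  by move=> s01 t01 ts; rewrite ler_pM2l ?invr_gt0//; exact: convex_symmetrization.
have p_le s t := @symmetric_monotone p s t psym pmon.
have m01 (i : 'I_n) := @midpoint01 R n i (ltn_ord i).
have z01 : 0 <= (0 : R) <= 1 by rewrite lexx ler01.
have h01 : 0 <= (2^-1 : R) <= 1 by apply/andP; split; lra.
have far t : 0 <= t <= 1 -> `|t - 2^-1| <= `|0 - 2^-1 : R|.
  move=> /andP[? ?]; rewrite sub0r normrN [leRHS]ger0_norm ?invr_ge0//.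
  by rewrite ler_norml; apply/andP; split; lra.
have near t : `|2^-1 - 2^-1 : R| <= `|t - 2^-1| by rewrite subrr normr0.
have flip g : midpoint_mean n g = midpoint_mean n (fun t => g (1 - t)).
  rewrite /midpoint_mean (reindex_inj rev_ord_inj) /=.
  by apply: eq_bigr => i _; rewrite midpoint_rev.
have mean_sym g :
    midpoint_mean n g = midpoint_mean n (fun t => 2^-1 * (g t + g (1 - t))).
  have -> : midpoint_mean n g = 2^-1 * (midpoint_mean n g + midpoint_mean n g) by field.
  rewrite {2}flip /midpoint_mean -big_split /= mulr_sumr.
  by apply: eq_bigr => i _; ring.
have phiE : midpoint_mean n phi = \sum_(i < n) n%:R^-1 * psi (midpoint n i).
  exact: mean_sym.
have pphiE : midpoint_mean n (fun t => p t * phi t) =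
    \sum_(i < n) n%:R^-1 * (p (midpoint n i) * psi (midpoint n i)).
  rewrite mean_sym; apply: eq_bigr => i _; congr (_ * _).
  by rewrite psym// /psi; ring.
have -> : 2^-1 * (phi 0 + phi 1) - phi 2^-1 = psi 0 - psi 2^-1.
  rewrite /psi subr0; congr (_ - _).
  have -> : 1 - 2^-1 = 2^-1 :> R by field.
  by field.
rewrite phiE pphiE; apply: covariance_bounds => // [i|i|i j].
- by apply/andP; split; apply: p_le => //; exact: far.
- by apply/andP; split; apply: psi_le => //; exact: far.
- have [ij|ji] := leP `|midpoint n i - 2^-1 : R| `|midpoint n j - 2^-1|.
    by rewrite mulr_ge0_le0 ?subr_ge0 ?subr_le0 ?p_le ?psi_le.
  have {}ji := ltW ji.
  by rewrite mulr_le0_ge0 ?subr_ge0 ?subr_le0 ?p_le ?psi_le.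
Qed.

(** Bounded variation of [p] on [[0, 1]], witnessed by a monotone [v] whose increments dominate
    those of [p]. *)
Definition bv_control p v :=
  (forall s t : R, 0 <= s -> s <= t -> t <= 1 -> v s <= v t) /\
  forall s t : R, 0 <= s <= 1 -> 0 <= t <= 1 -> `|p s - p t| <= `|v s - v t|.

(** [v] reflects [p] at the height [p 2^-1] on the right half. *)
Lemma symmetric_bv_control p : (forall t, 0 <= t <= 1 -> p (1 - t) = p t) ->
  {in `[0, 2^-1]%R &, {homo p : s t / s <= t}} -> exists v, bv_control p v.
Proof.
move=> psym pmon; pose v t := if t <= 2^-1 then p t else 2 * p 2^-1 - p t.
have p_le s t := @symmetric_monotone p s t psym pmon.
have h01 : 0 <= (2^-1 : R) <= 1 by apply/andP; split; lra.
have p_max t : 0 <= t <= 1 -> p t <= p 2^-1.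
  by move=> t01; apply: p_le => //; rewrite subrr normr0.
exists v.
have inc s t : 0 <= s -> s <= t -> t <= 1 ->
    v s <= v t /\ `|p s - p t| <= v t - v s.
  move=> s0 st t1; have s01 : 0 <= s <= 1 by rewrite s0 (le_trans st t1).
  have t01 : 0 <= t <= 1 by rewrite t1 (le_trans s0 st).
  have ps := p_max s s01; have pt := p_max t t01.
  rewrite /v; have [sh|hs] := leP s 2^-1; have [th|ht] := leP t 2^-1.
  - have pst : p s <= p t.
      by apply: pmon => //; rewrite in_itv/= ?s0 ?sh// (le_trans s0 st).
    by split=> //; rewrite ler0_norm ?subr_le0// opprB.
  - by split; [lra|rewrite ler_norml; apply/andP; split; lra].
  - by have := lt_le_trans hs (le_trans st th); rewrite ltxx.
  - have pts : p t <= p s.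
      by apply: p_le => //; rewrite !gtr0_norm ?subr_gt0// lerD2r.
    by split; [lra|rewrite ger0_norm ?subr_ge0//; lra].
split=> [s t s0 st t1|s t /andP[s0 s1] /andP[t0 t1]].
  by have [] := inc s t s0 st t1.
have [st|/ltW ts] := leP s t.
  by have [_ /le_trans] := inc s t s0 st t1; apply; rewrite distrC ler_norm.
rewrite distrC; have [_ /le_trans] := inc t s t0 ts s1; apply; exact: ler_norm.
Qed.

Lemma bv_controlN p v : bv_control p v -> bv_control (fun t => - p t) v.
Proof.
by move=> [vm pv]; split=> // s t s01 t01; rewrite -opprD normrN pv.
Qed.

Lemma bv_control_bounded p v : bv_control p v ->
  exists2 C : R, 0 <= C & forall t, 0 <= t <= 1 -> `|p t| <= C.
Proof.
move=> [vm pv]; exists (`|p 0| + (v 1 - v 0)) => [|t t01].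
  by rewrite addr_ge0// subr_ge0 vm.
have z01 : 0 <= (0 : R) <= 1 by rewrite lexx ler01.
rewrite -[p t](subrK (p 0)) addrC; apply: le_trans (ler_normD _ _) _.
rewrite lerD2l; apply: le_trans (pv _ _ t01 z01) _; case/andP: t01 => t0 t1.
by rewrite ger0_norm ?subr_ge0 ?vm// lerD2r vm.
Qed.

(** Clamping the argument to [[0, 1/2]] makes [p] monotone on the whole line; by symmetry [p] on
    [[0, 1]] is this function of [min t (1 - t)]. *)
Lemma symmetric_monotone_measurable p : (forall t, 0 <= t <= 1 -> p (1 - t) = p t) ->
  {in `[0, 2^-1]%R &, {homo p : s t / s <= t}} ->
  measurable_fun (`[0%R, 1%R] : set R) p.
Proof.
move=> psym pmon; pose c (t : R) := Num.max 0 (Num.min 2^-1 t).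
have cin t : c t \in `[0, 2^-1]%R.
  by rewrite in_itv /= le_max lexx /= ge_max invr_ge0 ler0n /= ge_min lexx.
have pc : nondecreasing_fun (p \o c).
  move=> s t st /=; apply: pmon => //.
  by apply: le_max2; last by apply: le_min2.
have cE t : 0 <= t <= 2^-1 -> c t = t.
  by move=> /andP[t0 th]; rewrite /c min_r// max_r.
apply: (@eq_measurable_fun _ _ _ _ _ ((p \o c) \o (fun t => Num.min t (1 - t)))).
  move=> t; rewrite inE /= in_itv /= => /andP[t0 t1].
  have [th|th] := leP t (1 - t); first by rewrite cE//; lra.
  by rewrite cE ?psym ?t0//; lra.
apply: measurable_funTS; apply: measurableT_comp.
  by apply: nondecreasing_measurable.
by apply: measurable_minr => //; apply: measurable_funB.
Qed.

(** On a cell, [p] differs from its midpoint value by at most the increment of [v], so the cell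
    error is that increment over [n], and the total is at most [(v 1 - v 0) / n]. *)
Lemma midpoint_mean_integral p v (e : R) : bv_control p v ->
  measurable_fun (`[0%R, 1%R] : set R) p -> 0 < e -> exists N, forall n, (N < n)%N ->
  `|midpoint_mean n p - \int[lebesgue_measure]_(t in `[0%R, 1%R]) p t| <= e.
Proof.
move=> pv mp e0; have [vm pvd] := pv; have [C C0 hC] := bv_control_bounded pv.
have i01 : lebesgue_measure.-integrable `[0%R, 1%R] (EFin \o p).
  apply: measurable_bounded_integrable => //.
    by rewrite /= lebesgue_measure_itv /= lte01 oppr0 adde0 ltry.
  exists C; split; first exact: num_real.
  by move=> c Cc t /=; rewrite in_itv /= => /hC/le_trans; apply; exact: ltW.
have ip (X : interval R) : [set` X] `<=` `[0%R, 1%R] ->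
    lebesgue_measure.-integrable [set` X] (EFin \o p).
  by move=> X01; apply: integrableS i01.
pose Phi u := \int[lebesgue_measure]_(t in `[0%R, u]) p t.
have Phi0 : Phi 0 = 0 by rewrite /Phi set_itv1 Rintegral_set1.
have V0 : 0 <= v 1 - v 0 by rewrite subr_ge0 vm.
have V1 : 0 < v 1 - v 0 + 1 by rewrite ltr_wpDl.
have [N hN] := uniform_partition_mesh (divr_gt0 e0 V1); exists N => n Nn.
have n0 : (0 < n)%N by exact: leq_ltn_trans Nn.
have n0' : 0 < n%:R :> R by rewrite ltr0n.
have sP := @uniform_partitionP R n n0.
have [_ _ sincr s01] := partition_nodes sP.
have := sum_node_diff Phi sP; rewrite Phi0 subr0 /Phi => <-; rewrite -/Phi.
have := sum_node_diff v sP; rewrite size_uniform_partition in sincr s01 * => vE.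
rewrite -sumrB; apply: le_trans (ler_norm_sum _ _ _) _.
apply: (@le_trans _ _ (\sum_(i < n)
    n%:R^-1 * (v (node (uniform_partition n) i.+1) -
                v (node (uniform_partition n) i)))).
  apply: ler_sum => i _; set u := node _ i; set w := node _ i.+1.
  have /andP[u0 u1] := s01 i (ltnW (ltn_ord i)).
  have /andP[w0 w1] := s01 i.+1 (ltn_ord i).
  have uw : u < w := sincr i (ltn_ord i).
  have wuE : w - u = n%:R^-1 by apply: uniform_partition_step.
  have sub : `]u, w] `<=` `[0%R, 1%R].
    move=> t /=; rewrite !in_itv /= => /andP[ut tw].
    by rewrite (le_trans u0 (ltW ut)) (le_trans tw w1).
  have PhiE : Phi w - Phi u = \int[lebesgue_measure]_(t in `]u, w]) p t.
    have i0w : lebesgue_measure.-integrable `[0%R, w] (EFin \o p).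
      by apply: ip => t /=; rewrite !in_itv /= => /andP[-> /le_trans -> //].
    by rewrite /Phi (Rintegral_itvB i0w) ?bnd_simp// ltW.
  set z := midpoint n i.
  have uz : u <= z <= w.
    rewrite /u /w /z !node_uniform_partition ?(ltnW (ltn_ord i))// /midpoint.
    rewrite !ler_pM2r ?invr_gt0// lerDl invr_ge0 ler0n /=.
    by rewrite -[i.+1%:R]natr1 lerD2l invf_le1// ler1n.
  have z01 : 0 <= z <= 1 by exact: midpoint01.
  have pt t : [set` `]u, w]] t -> p z - (v w - v u) <= p t <= p z + (v w - v u).
    move=> tuw; have /= t01 := sub t tuw.
    rewrite in_itv /= in t01; rewrite /= in_itv /= in tuw.
    have /andP[ut tw] := tuw; have /andP[uz1 zw] := uz.
    have /andP[t0 t1] := t01; have /andP[z0 z1] := z01.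
    have := pvd t z t01 z01.
    have : `|v t - v z| <= v w - v u.
      have := vm u t u0 (ltW ut) t1; have := vm t w t0 tw w1.
      have := vm u z u0 uz1 z1; have := vm z w z0 zw w1.
      by move=> ? ? ? ?; rewrite ler_norml; apply/andP; split; lra.
    move=> h1 h2; have := le_trans h2 h1; rewrite ler_norml => /andP[? ?].
    by apply/andP; split; lra.
  have cst_int (k : R) : \int[lebesgue_measure]_(t in `]u, w]) k = k * (w - u).
    rewrite Rintegral_cst//= lebesgue_measure_itv /= lte_fin uw.
    by [].
  have ic (k : R) : lebesgue_measure.-integrable `]u, w] (EFin \o (fun=> k)).
    apply: measurable_bounded_integrable => //.
      by rewrite /= lebesgue_measure_itv /= lte_fin uw -EFinD ltry.
    exists `|k|; split; first exact: num_real.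
    by move=> c kc t _ /=; exact: ltW.
  have lo : (p z - (v w - v u)) * (w - u) <= Phi w - Phi u.
    rewrite PhiE -cst_int; apply: le_Rintegral => //; first exact: ip.
    by move=> t /pt /andP[].
  have hi : Phi w - Phi u <= (p z + (v w - v u)) * (w - u).
    rewrite PhiE -cst_int; apply: le_Rintegral => //; first exact: ip.
    by move=> t /pt /andP[].
  rewrite wuE in lo hi; rewrite -/(Phi w) -/(Phi u) ler_norml; apply/andP; split; lra.
rewrite -mulr_sumr vE; apply: (@le_trans _ _ (n%:R^-1 * (v 1 - v 0 + 1))).
  by rewrite ler_wpM2l ?invr_ge0 ?(ltW n0')// lerDl.
by rewrite -ler_pdivlMr// ltW// hN.
Qed.

End Scalar.

(** * Operator inequalities *)

Section OperatorChebyshev.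
Context {R : realType} {H : completeNormedModType R[i]}.
Variable dot : {dot H for @Num.conj R[i]}.
Hypothesis dot_norm : forall x : H, dot x x = `|x| ^+ 2.
Variables (I : set R) (f : R -> R) (A B : H -> H).

Local Notation opseg t := ((t : R)%:C *: A + (1 - t)%:C *: B).
Local Notation F := (fun t : R => cfc f (opseg t)).

Lemma rdot_integral_cvg (G : R -> H -> H) J x y : is_op_integral 0 1 G J ->
  midpoint_mean n.+1 (fun t => rdot dot (G t x) y) @[n --> \oo] --> rdot dot (J x) y.
Proof.
move=> GJ; apply/cvgrPdist_le => e e0.
have y1 : 0 < nrm y + 1 by rewrite ltr_wpDl// nrm_ge0.
have [N hN] := op_integral_midpoint x GJ (divr_gt0 e0 y1).
exists N => // n /= Nn.
have -> : midpoint_mean n.+1 (fun t => rdot dot (G t x) y) =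
    rdot dot (\sum_(i < n.+1) (n.+1%:R^-1)%:C *: G (midpoint n.+1 i) x) y.
  by rewrite rdot_suml; apply: eq_bigr => i _; rewrite rdotZl.
rewrite distrC -rdotBl; apply: le_trans (rdot_le dot_norm _ _) _.
apply: le_trans (ler_wpM2r (nrm_ge0 y) (hN n.+1 _)) _ => //.
by rewrite mulrAC ler_pdivrMr// ler_wpM2l ?(ltW e0)// lerDl.
Qed.

Lemma opseg_convex (l s t : R) :
  (1 - l)%:C *: opseg s + l%:C *: opseg t = opseg ((1 - l) * s + l * t).
Proof.
apply/funext => x.
change ((1 - l)%:C *: (s%:C *: A x + (1 - s)%:C *: B x) +
  l%:C *: (t%:C *: A x + (1 - t)%:C *: B x) =
  ((1 - l) * s + l * t)%:C *: A x + (1 - ((1 - l) * s + l * t))%:C *: B x).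
rewrite !scalerDr !scalerA -!rmorphM addrACA -!scalerDl -!rmorphD.
by congr (_ + _%:C *: _); ring.
Qed.

Hypothesis f_convex : operator_convex dot I f.
Variables (m M : R).
Hypotheses (mM : m <= M) (mMI : `[m, M] `<=` I).
Hypotheses (bA : bounded_op A) (bB : bounded_op B).
Hypothesis AB : forall t : R, 0 <= t <= 1 -> SA dot `[m, M] (opseg t).

Let fc : {within `[m, M], continuous f}.
Proof. by apply: continuous_subspaceW mMI _; case: f_convex. Qed.

(** The oscillation splits as [p s (F s - F t) + (p s - p t) F t]: norm continuity makes the first
    term small, and [C |v s - v t|] bounds the second. *)
Lemma weighted_integral_exists (p v : R -> R) : bv_control p v ->
  exists J, is_op_integral 0 1 (fun t => (p t)%:C *: F t) J.
Proof.
move=> pv; have [vm pvd] := pv.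
have [Q Q0 hQ] := bv_control_bounded pv.
have [C C0 hC] := cfc_bounded dot_norm mM fc.
apply: (@op_integral_exists _ _ _ v (Q * C) C _ C0 vm) => [|t t01|e e0].
- exact: mulr_ge0.
- apply/opnorm_leP => x; change (nrm ((p t)%:C *: F t x) <= Q * C * nrm x).
  rewrite nrmZr -mulrA; apply: ler_pM; rewrite ?nrm_ge0 ?hQ//.
  by have /opnorm_leP := hC _ (AB t01); apply.
have Q1 : 0 < Q + 1 by rewrite ltr_wpDl.
have [d d0 hd] := cfc_segment_continuous dot_norm mM fc bA bB AB (divr_gt0 e0 Q1).
exists d => // s t s01 t01 st; apply/opnorm_leP => x.
change (nrm ((p s)%:C *: F s x - (p t)%:C *: F t x) <= (e + C * `|v s - v t|) * nrm x).
apply: le_trans (nrm_triangle ((p s)%:C *: F t x) _ _) _; rewrite mulrDl; apply: lerD.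
  rewrite -scalerBr nrmZr.
  have /opnorm_leP /(_ x) h := hd s t s01 t01 st.
  apply: le_trans (ler_pM _ (nrm_ge0 _) (hQ s s01) h) _ => //.
  rewrite mulrA ler_wpM2r ?nrm_ge0// mulrCA ler_piMr ?(ltW e0)//.
  by rewrite ler_pdivrMr// mul1r lerDl.
rewrite -scalerBl -rmorphB nrmZr mulrAC mulrC; apply: ler_pM; rewrite ?nrm_ge0 ?pvd//.
by have /opnorm_leP := hC _ (AB t01); apply.
Qed.

Lemma cfc_segment_convex x (l s t : R) : 0 <= l <= 1 -> 0 <= s <= 1 -> 0 <= t <= 1 ->
  rdot dot (F ((1 - l) * s + l * t) x) x <=
  (1 - l) * rdot dot (F s x) x + l * rdot dot (F t x) x.
Proof.
move=> l01 s01 t01; have [_ cvx] := f_convex.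
have := cvx l _ _ l01 (SA_subset mMI (AB s01)) (SA_subset mMI (AB t01)).
move=> /(_ x); rewrite opseg_convex lecE => /andP[_] /le_trans; apply.
change (rdot dot ((1 - l)%:C *: F s x + l%:C *: F t x) x <=
  (1 - l) * rdot dot (F s x) x + l * rdot dot (F t x) x).
by rewrite rdotDl !rdotZl.
Qed.

(** The real inequality is the limit of the midpoint inequalities for [phi]. The imaginary parts of
    [<J1 x, x>] and [<J2 x, x>] are limits of means that are all 0. *)
Lemma cfc_chebyshev_gruss (p : R -> R) (P : R) J1 J2 x :
  (forall t, 0 <= t <= 1 -> p (1 - t) = p t) ->
  {in `[0, 2^-1]%R &, {homo p : s t / s <= t}} ->
  midpoint_mean n.+1 p @[n --> \oo] --> P ->
  is_op_integral 0 1 F J1 -> is_op_integral 0 1 (fun t => (p t)%:C *: F t) J2 ->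
  0 <= dot ((P%:C *: J1 - J2) x) x /\
  dot ((P%:C *: J1 - J2) x) x <= dot (((4^-1 * (p 2^-1 - p 0))%:C *:
     (2^-1 *: (cfc f A + cfc f B) - cfc f (2^-1 *: (A + B)))) x) x.
Proof.
move=> psym pmon pP FJ1 FJ2.
have z01 : 0 <= (0 : R) <= 1 by rewrite lexx ler01.
have o01 : 0 <= (1 : R) <= 1 by rewrite lexx ler01.
have h01 : 0 <= (2^-1 : R) <= 1 by apply/andP; split; lra.
have F0 : F 0 = cfc f B.
  congr (cfc f _); apply/funext => y; change (0%:C *: A y + (1 - 0)%:C *: B y = B y).
  by rewrite subr0 rmorph0 rmorph1 scale0r scale1r add0r.
have F1 : F 1 = cfc f A.
  congr (cfc f _); apply/funext => y; change (1%:C *: A y + (1 - 1)%:C *: B y = A y).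
  by rewrite subrr rmorph0 rmorph1 scale0r scale1r addr0.
have C2 : (2^-1 : R)%:C = 2^-1 by rewrite fmorphV rmorph_nat.
have Fh : F 2^-1 = cfc f (2^-1 *: (A + B)).
  congr (cfc f _); apply/funext => y.
  change ((2^-1)%:C *: A y + (1 - 2^-1)%:C *: B y = 2^-1 *: (A y + B y)).
  by have -> : 1 - 2^-1 = 2^-1 :> R; [field|rewrite C2 scalerDr].
have FIm t : 0 <= t <= 1 -> rdot dot (F t x) ('i%C *: x) = 0.
  by move=> t01; rewrite rdot_iZ; exact: cfc_dot_Im (AB t01).
have mean0 (g : R -> R) n : (forall t, 0 <= t <= 1 -> g t = 0) -> midpoint_mean n g = 0.
  by move=> g0; apply: big1 => i _; rewrite g0 ?mulr0//; exact: midpoint01.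
have ImJ (G : R -> H -> H) J : is_op_integral 0 1 G J ->
    (forall t, 0 <= t <= 1 -> rdot dot (G t x) ('i%C *: x) = 0) ->
    complex.Im (dot (J x) x) = 0.
  move=> GJ G0; rewrite -rdot_iZ.
  have := cvg_lim (@Rhausdorff R) (@rdot_integral_cvg _ _ x ('i%C *: x) GJ); move=> <-.
  have -> : (fun n => midpoint_mean n.+1 (fun t => rdot dot (G t x) ('i%C *: x))) =
      cst 0 by apply/funext => n; exact: mean0.
  by apply: cvg_lim; [exact: Rhausdorff|exact: cvg_cst].
have J1Im := ImJ _ _ FJ1 FIm.
have J2Im : complex.Im (dot (J2 x) x) = 0.
  apply: ImJ FJ2 _ => t t01; change (rdot dot ((p t)%:C *: F t x) ('i%C *: x) = 0).
  by rewrite rdotZl FIm// mulr0.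
pose phi t := rdot dot (F t x) x.
have bounds n := @midpoint_chebyshev_gruss R p phi n.+1 isT psym pmon
  (@cfc_segment_convex x).
have lim1 := @rdot_integral_cvg _ _ x x FJ1.
have lim2 : midpoint_mean n.+1 (fun t => p t * phi t) @[n --> \oo] -->
    rdot dot (J2 x) x.
  apply: cvg_trans (@rdot_integral_cvg _ _ x x FJ2); apply: near_eq_cvg.
  apply: nearW => n; apply: eq_bigr => i _; congr (_ * _).
  exact: (rdotZl dot (p _) (F _ x) x).
have limD : midpoint_mean n.+1 p * midpoint_mean n.+1 phi -
    midpoint_mean n.+1 (fun t => p t * phi t) @[n --> \oo] -->
    P * rdot dot (J1 x) x - rdot dot (J2 x) x.
  by apply: cvgB => //; apply: cvgM.
have lo : 0 <= P * rdot dot (J1 x) x - rdot dot (J2 x) x.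
  by apply: (cvgr_to_ge limD); apply: nearW => n; have /andP[] := bounds n.
have hi : P * rdot dot (J1 x) x - rdot dot (J2 x) x <=
    4^-1 * (p 2^-1 - p 0) * (2^-1 * (phi 0 + phi 1) - phi 2^-1).
  by apply: (cvgr_to_le limD); apply: nearW => n; have /andP[] := bounds n.
set w : R := 4^-1 * (p 2^-1 - p 0) in hi *.
have realE (z : R[i]) : complex.Im z = 0 -> z = (complex.Re z)%:C.
  by case: z => a b /= ->.
have DE : dot ((P%:C *: J1 - J2) x) x =
    (P * rdot dot (J1 x) x - rdot dot (J2 x) x)%:C.
  change (dot (P%:C *: J1 x - J2 x) x =
    (P * rdot dot (J1 x) x - rdot dot (J2 x) x)%:C).
  rewrite dotBl dotZl (realE _ J1Im) (realE _ J2Im).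
  by rewrite rmorphB rmorphM.
have WE : dot ((w%:C *: (2^-1 *: (cfc f A + cfc f B) - cfc f (2^-1 *: (A + B)))) x) x =
    (w * (2^-1 * (phi 0 + phi 1) - phi 2^-1))%:C.
  change (dot (w%:C *: (2^-1 *: (cfc f A x + cfc f B x) - cfc f (2^-1 *: (A + B)) x)) x =
    (w * (2^-1 * (phi 0 + phi 1) - phi 2^-1))%:C).
  rewrite -F0 -F1 -Fh -C2 dotZl dotBl dotZl dotDl.
  have FE t : 0 <= t <= 1 -> dot (F t x) x = (phi t)%:C.
    by move=> t01; apply: realE; rewrite -rdot_iZ FIm.
  rewrite (FE 0 z01) (FE 1 o01) (FE _ h01) (addrC (phi 0)).
  by rewrite -rmorphD -rmorphM -rmorphB -rmorphM.
by rewrite DE WE ler0c lecR.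
Qed.

End OperatorChebyshev.

Lemma midpoint_mean_cvg (R : realType) (p v : R -> R) : bv_control p v ->
  measurable_fun (`[0%R, 1%R] : set R) p -> midpoint_mean n.+1 p @[n --> \oo] -->
  \int[lebesgue_measure]_(t in `[0%R, 1%R]) p t.
Proof.
move=> pv mp; apply/cvgrPdist_le => e e0.
have [N hN] := midpoint_mean_integral pv mp e0.
by exists N => // n /= Nn; rewrite distrC hN.
Qed.

(** * Symmetric weights and the two inequalities *)

Section SymmetricWeights.
Context {R : realType} {H : completeNormedModType R[i]}.
Variable dot : {dot H for @Num.conj R[i]}.
Hypothesis dot_norm : forall x : H, dot x x = `|x| ^+ 2.

Lemma is_op_integralN (G : R -> H -> H) J a b :
  is_op_integral a b G J -> is_op_integral a b (fun t => - G t) (- J).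
Proof.
move=> GJ e e0; have [d d0 hd] := GJ e e0; exists d => // s xi sxi sd.
have /opnorm_leP h := hd s xi sxi sd; apply/opnorm_leP => x.
have -> : riemann_sum (fun t => - G t) a s xi - - J = - (riemann_sum G a s xi - J).
  rewrite opprB opprK addrC /riemann_sum -sumrN; congr (J + _).
  by apply: eq_bigr => i _; rewrite scalerN.
by rewrite nrmN.
Qed.

Lemma op_integralP (G : R -> H -> H) a b :
  (exists J, is_op_integral a b G J) -> is_op_integral a b G (op_integral a b G).
Proof. exact: xgetPex. Qed.

Variables (I : set R) (f : R -> R) (A B : H -> H).
Hypothesis I_interval : is_interval I.
Hypothesis f_convex : operator_convex dot I f.
Hypotheses (A_SA : SA dot I A) (B_SA : SA dot I B).

Local Notation F := (fun t : R => cfc f (t%:C *: A + (1 - t)%:C *: B)).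

(** The bounds hold for every integral [J] of the weighted function, not just the one selected by
    [op_integral], so that the negative of a selected integral can be inserted when the weight
    changes sign. The integral of [- p] is recorded for the same purpose. *)
Lemma symmetric_weight_bounds (p : R -> R) x : x != 0 ->
  (forall t, 0 <= t <= 1 -> p (1 - t) = p t) ->
  {in `[0, 2^-1]%R &, {homo p : s t / s <= t}} ->
  let P := \int[lebesgue_measure]_(t in `[0%R, 1%R]) p t in
  [/\ is_op_integral 0 1 F (op_integral 0 1 F),
    is_op_integral 0 1 (fun t => (p t)%:C *: F t)
      (op_integral 0 1 (fun t => (p t)%:C *: F t)),
    \int[lebesgue_measure]_(t in `[0%R, 1%R]) (- p t) = - P &
    forall J, is_op_integral 0 1 (fun t => (p t)%:C *: F t) J ->
    let D := P%:C *: op_integral 0 1 F - J in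
    0 <= dot (D x) x /\
    dot (D x) x <= dot (((4^-1 * (p 2^-1 - p 0))%:C *:
      (2^-1 *: (cfc f A + cfc f B) - cfc f (2^-1 *: (A + B)))) x) x].
Proof.
move=> x0 psym pmon P.
have [m [M [mM mMI AB]]] := SA_segment dot_norm x0 I_interval A_SA B_SA.
have [bA _ _] := A_SA; have [bB _ _] := B_SA.
have [v pv] := symmetric_bv_control psym pmon.
have mp := symmetric_monotone_measurable psym pmon.
have pP := midpoint_mean_cvg pv mp.
have ex1 : exists J, is_op_integral 0 1 F J.
  (* The unweighted integral is the case of the constant weight 1, which has zero variation. *)
  have c10 : bv_control (fun=> 1 : R) (fun=> 0 : R).
    by split=> // s t _ _; rewrite !subrr.
  have [J] := weighted_integral_exists dot_norm f_convex mM mMI bA bB AB c10.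
  by under eq_fun do rewrite rmorph1 scale1r; exists J.
have FJ1 := op_integralP ex1.
split => //.
- apply: op_integralP.
  exact: (weighted_integral_exists dot_norm f_convex mM mMI bA bB AB pv).
- have mNp := measurableT_comp (@oppr_measurable R _) mp.
  have := midpoint_mean_cvg (bv_controlN pv) mNp.
  move=> /(cvg_lim (@Rhausdorff R)) <-; apply: cvg_lim; first exact: Rhausdorff.
  rewrite (_ : (fun n => _) = fun n => - midpoint_mean n.+1 p); first exact: cvgN.
  apply/funext => n; rewrite /midpoint_mean -sumrN.
  by apply: eq_bigr => i _; rewrite mulrN.
- move=> J FJ.
  exact: (cfc_chebyshev_gruss dot_norm f_convex mM mMI AB x psym pmon pP FJ1 FJ).
Qed.

End SymmetricWeights.

Unset Implicit Arguments.

Theorem theorem2 (R : realType) (H : completeNormedModType R[i])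
    (dot : {dot H for @Num.conj R[i]})
    (dot_norm : forall x : H, dot x x = `|x| ^+ 2)
    (I : set R) (I_interval : is_interval I)
    (f : R -> R) (f_convex : operator_convex dot I f)
    (A B : H -> H) (A_SA : SA dot I A) (B_SA : SA dot I B) :
  (forall p : R -> R,
     (forall t, 0 <= t <= 1 -> p (1 - t) = p t) ->
     {in `[0, 2^-1]%R &, {homo p : s t / s <= t}} ->
     let F := fun t : R => cfc f (t%:C *: A + (1 - t)%:C *: B) in
     let D := (\int[lebesgue_measure]_(t in `[0%R, 1%R]) p t)%:C
                *: op_integral 0 1 F
              - op_integral 0 1 (fun t => (p t)%:C *: F t) in
     op_le dot 0 D /\
     op_le dot D
       ((4^-1 * (p 2^-1 - p 0))%:C
          *: (2^-1 *: (cfc f A + cfc f B) - cfc f (2^-1 *: (A + B)))))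
  /\
  (forall p : R -> R,
     (forall t, 0 <= t <= 1 -> p (1 - t) = p t) ->
     {in `[0, 2^-1]%R &, {homo p : s t / s <= t >-> t <= s}} ->
     let F := fun t : R => cfc f (t%:C *: A + (1 - t)%:C *: B) in
     let D := op_integral 0 1 (fun t => (p t)%:C *: F t)
              - (\int[lebesgue_measure]_(t in `[0%R, 1%R]) p t)%:C
                  *: op_integral 0 1 F in
     op_le dot 0 D /\
     op_le dot D
       ((4^-1 * (p 0 - p 2^-1))%:C
          *: (2^-1 *: (cfc f A + cfc f B) - cfc f (2^-1 *: (A + B))))).
Proof.
split=> p psym pmon F D.
  suff bounds x : dot ((0 : H -> H) x) x <= dot (D x) x /\ dot (D x) x <=
      dot (((4^-1 * (p 2^-1 - p 0))%:C *:
        (2^-1 *: (cfc f A + cfc f B) - cfc f (2^-1 *: (A + B)))) x) x.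
    by split=> x; have [] := bounds x.
  (* A nonzero [x] also certifies that the space is not zero, so that the spectra of [A] and [B] are
     nonempty. *)
  have [->|x0] := eqVneq x 0; first by rewrite !linear0r.
  have [_ FJ _ h] := symmetric_weight_bounds dot_norm I_interval f_convex A_SA B_SA
    x0 psym pmon.
  by rewrite -[(0 : H -> H) x]/(0 : H) linear0l; exact: h FJ.
pose q t := - p t.
have qsym t : 0 <= t <= 1 -> q (1 - t) = q t by move=> t01; rewrite /q psym.
have qmon : {in `[0, 2^-1]%R &, {homo q : s t / s <= t}}.
  by move=> s t sh th st; rewrite lerN2 pmon.
have qqE : (fun t => - q t) = p by apply/funext => t; rewrite /q opprK.
suff bounds x : dot ((0 : H -> H) x) x <= dot (D x) x /\ dot (D x) x <=
    dot (((4^-1 * (p 0 - p 2^-1))%:C *: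
      (2^-1 *: (cfc f A + cfc f B) - cfc f (2^-1 *: (A + B)))) x) x.
  by split=> x; have [] := bounds x.
have [->|x0] := eqVneq x 0; first by rewrite !linear0r.
have [_ FJ Pq h] := symmetric_weight_bounds dot_norm I_interval f_convex A_SA B_SA
  x0 qsym qmon.
rewrite qqE in Pq.
have qFE : (fun t => - ((q t)%:C *: F t)) = (fun t => (p t)%:C *: F t).
  by apply/funext => t; rewrite /q rmorphN scaleNr opprK.
have pqFE : (fun t => - ((p t)%:C *: F t)) = (fun t => (q t)%:C *: F t).
  by apply/funext => t; rewrite /q rmorphN scaleNr.
have pJ : is_op_integral 0 1 (fun t => (p t)%:C *: F t)
    (op_integral 0 1 (fun t => (p t)%:C *: F t)).
  by apply: op_integralP; exists (- op_integral 0 1 (fun t => (q t)%:C *: F t));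
     rewrite -qFE; exact: is_op_integralN.
(* The negative of the selected integral for [p] is an integral for [q = - p]; as the mean of [q] is
   minus that of [p], the difference bounded by [h] is exactly [D]. *)
have := h (- op_integral 0 1 (fun t => (p t)%:C *: F t)).
rewrite -pqFE => /(_ (is_op_integralN pJ)) /=.
rewrite -[(0 : H -> H) x]/(0 : H) linear0l.
have -> : (\int[lebesgue_measure]_(t in `[0%R, 1%R]) q t)%:C *: op_integral 0 1 F -
    - op_integral 0 1 (fun t => (p t)%:C *: F t) = D.
  by rewrite /D Pq opprK addrC rmorphN scaleNr opprK.
by rewrite /q opprK (addrC (- p _)).
Qed.
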